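(* Let $(\mathcal{L},\Pi)=(\Omega,\pi)^{\Gamma}$ be the space of random Lorentz gases described in the context. Let $\mathcal{C}$ be the $\sigma$-algebra defined on $\Omega$, let $\mathcal{A}=\mathcal{C}^{\otimes\Gamma}$ be the product $\sigma$-algebra on $\mathcal{L}$, and let $\overline{\mathcal{A}}^{\Pi}$ be its completion with respect to $\Pi$. Let $$\mathcal{R}:=\{\ell\in\mathcal{L} : \ell \text{ is a recurrent Lorentz gas}\}.$$ Then $\mathcal{R}\in\overline{\mathcal{A}}^{\Pi}$ and $\Pi(\mathcal{R})\in\{0,1\}$.
   Context: **Lorentz gas (LG).** Let $\{\mathcal{O}_\alpha\}_{\alpha\in\mathcal{I}}$ be a countable family of pairwise disjoint, open, bounded, convex subsets of $\mathbb{R}^2$ with $C^3$ boundary (the scatterers). The term Lorentz gas denotes both this family (the configuration) and the billiard system in $\mathbb{R}^2\setminus\bigcup_\alpha\mathcal{O}_\alpha$: a point particle moves at unit speed along straight lines and, when it hits a scatterer, is reflected with angle of reflection equal to angle of incidence. Let $L_\alpha$ be the length of $\partial\mathcal{O}_\alpha$ and $\mathcal{M}_\alpha:=S^1_{L_\alpha}\times[0,\pi]$, where $S^1_{L}$ is the circle of circumference $L$. A pair $x=(r,\varphi)\in\mathcal{M}_\alpha$ represents $(q,v)$, where $q\in\partial\mathcal{O}_\alpha$ has counterclockwise arc-length coordinate $r$ and $v$ is the unit vector based at $q$, pointing out of $\mathcal{O}_\alpha$, that forms a counterclockwise angle $\varphi$ with the tangent line at $q$. The phase space is the disjoint union $\mathcal{M}:=\bigsqcup_\alpha\mathcal{M}_\alpha$.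 The billiard map $T$ sends $x$, representing $(q,v)$, to $x_1$, representing $(q_1,v_1)$, where $q_1$ is the first collision point of the particle leaving $q$ with velocity $v$, and $v_1$ is the post-collisional velocity there. $T$ (defined up to null sets, as singular, i.e. tangential, trajectories are neglected) preserves the measure $d\mu=\sin\varphi\,dr\,d\varphi$. Let $k(x)$ be the curvature of the boundary at $q$ and $\tau(x)$ the distance between $q$ and $q_1$. Standing assumption: there are constants $k_m,k_M,\tau_m,\tau_M>0$ such that $k_m\le k(x)\le k_M$ and $\tau_m\le\tau(x)\le\tau_M$ for all $x\in\mathcal{M}$ (the last inequality is the finite horizon condition). **Recurrence.** The LG is recurrent if $(\mathcal{M},T,\mu)$ is Poincaré recurrent: for every measurable $A\subseteq\mathcal{M}$, for $\mu$-a.e. $x\in A$ there is $n\ge1$ with $T^nx\in A$. **The space $\mathcal{L}$.** $\Gamma\subset\mathbb{R}^2$ is a co-compact lattice and $\mathbb{R}^2=\bigcup_{\gamma\in\Gamma}C_\gamma$ is a corresponding partition into cells $C_\gamma=C_0+\gamma$, with $C_\gamma\cap C_\eta=\emptyset$ for $\gamma\ne\eta$. $(\Omega,\mathcal{C},\pi)$ is a probability space, and each $\omega\in\Omega$ determines a finite configuration of scatterers in a cell, depending measurably on $\omega$ (so that the billiard dynamics is jointly measurable in the phase-space point and the configuration). In each cell $C_\gamma$ one places (a translate of) the configuration given by $\ell_\gamma\in\Omega$; a fixed $\Gamma$-periodic family of non-random scatterers may also be present in every configuration. The $\ell_\gamma$ are i.i.d. with law $\pi$, so that $(\mathcal{L},\Pi):=(\Omega,\pi)^\Gamma$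 (product of $\Gamma$ copies), and each $\ell=\{\ell_\gamma\}_{\gamma\in\Gamma}\in\mathcal{L}$ is identified with the corresponding LG. It is assumed that every $\ell\in\mathcal{L}$ is a LG satisfying the standing assumption above. *)

(* Defs.v *)
From HB Require Import structures.
From mathcomp Require Import all_boot all_order all_algebra.
From mathcomp Require Import all_classical all_reals all_analysis.
From mathcomp Require Import measurable_realfun.

Set Implicit Arguments.
Unset Strict Implicit.
Unset Printing Implicit Defensive.
Import Order.TTheory GRing.Theory Num.Theory.
Import numFieldNormedType.Exports.

Local Open Scope classical_set_scope.
Local Open Scope ring_scope.

Section plane.
Context {R : realType}.
Implicit Types u v : R * R.

Definition dot u v : R := u.1 * v.1 + u.2 * v.2.

Definition cross u v : R := u.1 * v.2 - u.2 * v.1.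

(* [u] rotated counterclockwise by pi/2 *)
Definition perp u : R * R := (- u.2, u.1).

(* Reflection across the line spanned by the unit vector [u]: it keeps the
   component along [u] and changes the sign of the component along [perp u]. *)
Definition reflect_along u v : R * R := (2 * dot v u) *: u - v.

Definition C3 (f : R -> R * R) : Prop :=
  (forall n : nat, (n < 3)%N -> forall r : R, derivable (derive1n n f) r 1) /\
  continuous (derive1n 3 f).

End plane.

(* A scatterer comes with an arc-length parametrization of its boundary, i.e.
   with a choice of the point of the boundary that has coordinate r = 0. *)
Record scatterer (R : realType) := Scatterer {
  body : set (R * R);
  perim : R;
  bdry : R -> R * R
}.

Section scatterers.
Context {R : realType}.
Implicit Types S : scatterer R.

Definition tangent S (r : R) : R * R := derive1 (bdry S) r.

Definition curvature S (r : R) : R := cross (tangent S r) (derive1n 2 (bdry S) r).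

(* [bdry] descends to a bijection from the circle R / perim Z onto the boundary
   of [body]. The last condition says that the body lies to the left of each
   oriented tangent line, i.e. that the boundary is run counterclockwise. *)
Record is_scatterer S : Prop := IsScatterer {
  body_open : open (body S);
  body_bounded : bounded_set (body S);
  body_convex : convex_set (body S : set (convex_lmodType (R * R)%type));
  perim_gt0 : 0 < perim S;
  bdry_C3 : C3 (bdry S);
  bdry_periodic : forall r, bdry S (r + perim S) = bdry S r;
  bdry_inj : {in `[0, perim S[ &, injective (bdry S)};
  bdry_image : bdry S @` [set` `[0, perim S[] = closure (body S) `\` body S;
  bdry_unit_speed : forall r, dot (tangent S r) (tangent S r) = 1;
  bdry_ccw : forall r p, body S p -> 0 < cross (tangent S r) (p - bdry S r)
}.

Definition translate (w : R * R) S : scatterer R :=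
  Scatterer [set p + w | p in body S] (perim S) (fun r => bdry S r + w).

(* [z = (r, phi)]. As the boundary is run counterclockwise, the outward vectors
   are to the right of the tangent vector u; hence v is outward and forms the
   counterclockwise angle phi in [0, pi] with the tangent line when v is - u
   rotated counterclockwise by phi. *)
Definition position S (z : R * R) : R * R := bdry S z.1.

Definition velocity S (z : R * R) : R * R :=
  - (cos z.2 *: tangent S z.1 + sin z.2 *: perp (tangent S z.1)).

(* S^1_L x [0, pi], with the circle S^1_L represented by [0, L[ *)
Definition coordinates S : set (R * R) := `[0, perim S[ `*` `[0, pi].

End scatterers.

Definition discrete (I : Type) : Type := I.

HB.instance Definition _ (I : pointedType) := Pointed.on (discrete I).
HB.instance Definition _ (I : pointedType) :=
  @isMeasurable.Build default_measure_display (discrete I)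
    discrete_measurable discrete_measurable0
    discrete_measurableC discrete_measurableU.

(* A family of scatterers indexed by the [i : I] such that [G i] is not [None]
   (the set of these indices may depend on the configuration). *)
Definition gas (R : realType) (I : Type) := I -> option (scatterer R).

(* The phase space of every gas indexed in [I] is a subset of [phase R I]; as a
   measurable space, [phase R I] is the disjoint union of copies of R x R. *)
Definition phase (R : realType) (I : pointedType) := (discrete I * (R * R))%type.

Section billiard.
Context {R : realType} {I : pointedType}.
Implicit Types (G : gas R I) (x y : phase R I).

Record lorentz_gas G : Prop := LorentzGas {
  gas_countable : countable [set i | G i <> None];
  gas_scatterer : forall i S, G i = Some S -> is_scatterer S;
  gas_disjoint : forall i j S S', G i = Some S -> G j = Some S' ->
    i <> j -> body S `&` body S' = set0
}.

Definition phase_space G : set (phase R I) :=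
  [set x | exists2 S, G x.1 = Some S & coordinates S x.2].

Definition obstacles G : set (R * R) :=
  [set q | exists i S, G i = Some S /\ closure (body S) q].

(* The particle that leaves [q] with unit velocity [v] has its first collision
   after the time (and distance) [t]; a tangential contact is a collision. *)
Definition first_hit G (q v : R * R) (t : R) : Prop :=
  [/\ 0 < t, obstacles G (q + t *: v) &
      forall s, 0 < s -> s < t -> ~ obstacles G (q + s *: v)].

Definition collision G x y : Prop :=
  exists S S' t,
    [/\ G x.1 = Some S /\ coordinates S x.2,
        G y.1 = Some S' /\ coordinates S' y.2,
        first_hit G (position S x.2) (velocity S x.2) t,
        position S' y.2 = position S x.2 + t *: velocity S x.2 &
        velocity S' y.2 =
          reflect_along (tangent S' y.2.1) (velocity S x.2)].

(* The value [x] is a dummy one for the [x] without next collision. *)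
Definition billiard_map G x : phase R I := xget x (collision G x).

Definition standing_assumption G : Prop :=
  exists km kM tm tM : R,
    [/\ [/\ 0 < km, 0 < kM, 0 < tm & 0 < tM],
        forall i S r, G i = Some S -> km <= curvature S r <= kM &
        forall i S z, G i = Some S -> coordinates S z ->
          exists2 t, first_hit G (position S z) (velocity S z) t &
                     tm <= t <= tM].

Definition billiard_measure G (A : set (phase R I)) : \bar R :=
  (\esum_(i in [set: I])
    if G i is Some s then
      \int[lebesgue_measure \x lebesgue_measure]_(z in
        coordinates s `&` [set z | A (i, z)]) (sin z.2)%:E
    else 0)%E.

Definition recurrent G : Prop :=
  forall A : set (phase R I), measurable A -> A `<=` phase_space G ->
  {ae billiard_measure G, forall x, A x ->
    exists2 n : nat, (1 <= n)%N & A (iter n (billiard_map G) x)}.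

End billiard.

Section lattice.
Context {R : realType}.
Variables e1 e2 : R * R.

(* The lattice Gamma with basis (e1, e2); gamma in Gamma is given by its two
   integer coordinates. *)
Definition lattice_vector (g : int * int) : R * R :=
  g.1%:~R *: e1 + g.2%:~R *: e2.

Definition is_cell (C0 : set (R * R)) : Prop :=
  let C g := [set p + lattice_vector g | p in C0] in
  \bigcup_(g in [set: int * int]) C g = setT /\
  forall g h, g <> h -> C g `&` C h = set0.

End lattice.

(* [(g, inl i)] is the index of the i-th random scatterer of the cell C_g;
   [(g, inr j)] is the index of the translate by g of the j-th representative
   of the Gamma-orbits of non-random scatterers. *)
Definition site := ((int * int) * (nat + nat))%type.
HB.instance Definition _ := Choice.on site.
HB.instance Definition _ := isPointed.Build site ((0, 0), inl 0%N).

Section random_gas.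
Context {R : realType} {d : measure_display} {Omega : measurableType d}.

Definition cylinders : set (set (int * int -> Omega)) :=
  [set X | exists g B, measurable B /\ X = [set l | B (l g)]].

Definition gas_space : Type := g_sigma_algebraType cylinders.
HB.instance Definition _ := Measurable.on gas_space.

Definition is_product_law
    (P : probability Omega R) (Q : probability gas_space R) : Prop :=
  forall (s : seq (int * int)) (B : int * int -> set Omega),
    uniq s -> (forall g, measurable (B g)) ->
    Q [set l | forall g, g \in s -> B g (l g)] = (\prod_(g <- s) P (B g))%E.

Variables (e1 e2 : R * R) (fixed : nat -> option (scatterer R)).
Variable config : Omega -> seq (scatterer R).

Definition random_gas (l : gas_space) : gas R site := fun a =>
  omap (translate (lattice_vector e1 e2 a.1))
    (match a.2 with
     | inl i => onth (config (l a.1)) i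
     | inr j => fixed j
     end).

Record measurable_config : Prop := MeasurableConfig {
  measurable_size : measurable_fun setT (fun w => size (config w));
  measurable_perim : forall i, measurable_fun setT
    (fun w => oapp (@perim R) 0 (onth (config w) i));
  measurable_bdry : forall i, measurable_fun setT
    (fun z : Omega * R => oapp (fun S => bdry S z.2) 0 (onth (config z.1) i));
  measurable_dynamics :
    measurable_fun
      [set z : gas_space * phase R site | phase_space (random_gas z.1) z.2]
      (fun z => billiard_map (random_gas z.1) z.2)
}.

End random_gas.
Arguments gas_space {d} Omega.

(* Main.v *)
From HB Require Import structures.
Require Import Defs.
From mathcomp Require Import all_boot all_order all_algebra.
From mathcomp Require Import all_classical all_reals all_analysis.
From mathcomp Require Import measurable_realfun.
From mathcomp Require Import ring lra.

(* A wandering set W and a set F of finite measure satisfy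
   sum_(n < N) mu (W & T^-n F) <= mu F when T preserves mu, because the sets
   T^-(N - n) W are disjoint; so almost every wandering orbit visits F finitely
   often. Hence a gas is recurrent iff almost every point returns to its own
   scatterer. This condition is measurable in the configuration, by Tonelli.
   If two gases differ in one cell, then their maps coincide outside a set of
   finite measure, that a wandering orbit of the second gas eventually avoids;
   from then on it is an orbit of the first gas. So recurrence of the first gas
   implies that of the second one, and Kolmogorov's zero-one law applies.

   Both uses of the counting argument need the invariance of the billiard
   measure. On each scatterer, this measure is the pullback of the measure
   d theta dp on oriented lines (theta = direction, p = offset) by the map
   taking a point to its outgoing line, and likewise by the map taking a point
   to its incoming line. For each direction, a line that is not tangent to any
   scatterer leaves one scatterer towards another iff it arrives there from the
   former, and there are only countably many tangent lines. *)

Set Implicit Arguments.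
Unset Strict Implicit.
Unset Printing Implicit Defensive.
Import Order.TTheory GRing.Theory Num.Theory.
Import numFieldNormedType.Exports.
Local Open Scope classical_set_scope.
Local Open Scope ring_scope.

(** * Conservative transformations *)

(** The billiard measure need not be finite, so Poincaré's theorem gives nothing by itself;
    finiteness enters only through single scatterers and through the scatterers of one cell, which
    are finitely many because [config] returns a finite sequence. The obstacle to measurability is
    that [recurrent] quantifies over all measurable sets of phase points; testing only the countably
    many sites removes it, and the event turns out to lie in the product sigma-algebra itself,
    before completion. All gases live on one space [phase R site], where [billiard_map] is the
    identity off the phase space of the gas. Hence maps and measures of two different gases can be
    compared directly, and the abstract arguments concern total maps of a fixed space. The
    invariance proof through lines never differentiates the billiard map: its only calculus is a
    change of variables for functions of one real variable. The standing assumption is used beyond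
    the existence of collisions: the positive lower bound on the free path keeps scatterers from
    touching, so that the scatterer hit is unique. *)

Definition no_return X (T : X -> X) (A : set X) : set X :=
  [set x | A x /\ forall n, (0 < n)%N -> ~ A (iter n T x)].

Section conservativity.
Context d (X : measurableType d) (R : realType).
Implicit Types (mu : {measure set X -> \bar R}) (T : X -> X).
Local Open Scope ereal_scope.

Definition measure_preserving mu T :=
  forall A, measurable A -> mu (T @^-1` A) = mu A.

Definition conservative mu T :=
  forall A, measurable A -> mu (no_return T A) = 0.

Lemma measurable_preimage_iter T n A : measurable_fun setT T ->
  measurable A -> measurable (iter n T @^-1` A).
Proof.
move=> mT; elim: n A => [|n IH] A mA; first by [].
have -> : iter n.+1 T @^-1` A = iter n T @^-1` (T @^-1` A) by [].
by apply: IH; rewrite -[_ @^-1` _]setTI; exact: mT.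
Qed.

Lemma measurable_no_return T A : measurable_fun setT T ->
  measurable A -> measurable (no_return T A).
Proof.
move=> mT mA.
have -> : no_return T A = A `&` \bigcap_(n in [set n | (0 < n)%N])
    ~` (iter n T @^-1` A).
  by apply/seteqP; split=> x /=; case=> Ax nA; split=> // n; exact: nA.
apply: measurableI => //; apply: bigcap_measurable; first by exists 1%N.
by move=> n _; apply: measurableC; exact: measurable_preimage_iter.
Qed.

Lemma measure_preimage_iter mu T n A : measurable_fun setT T ->
  measure_preserving mu T -> measurable A -> mu (iter n T @^-1` A) = mu A.
Proof.
move=> mT pT; elim: n A => [|n IH] A mA; first by [].
have -> : iter n.+1 T @^-1` A = iter n T @^-1` (T @^-1` A) by [].
by rewrite IH ?pT// -[_ @^-1` _]setTI; exact: mT.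
Qed.

Lemma negligible_preimage_iter mu T n A : measurable_fun setT T ->
  measure_preserving mu T -> mu.-negligible A ->
  mu.-negligible (iter n T @^-1` A).
Proof.
move=> mT pT [B [mB B0 AB]]; exists (iter n T @^-1` B); split.
- exact: measurable_preimage_iter.
- by rewrite measure_preimage_iter.
- by move=> x /AB.
Qed.

Definition wandering T (W : set X) :=
  forall x n, W x -> (0 < n)%N -> ~ W (iter n T x).

Lemma wandering_no_return T A : wandering T (no_return T A).
Proof. by move=> x n [_ h] n0 [An _]; exact: (h n n0 An). Qed.

(* By invariance the n-th term is the measure of T^-(N-n) W in T^-N F, and the
   sets T^-(N-n) W are disjoint. *)
Lemma sum_visits_le mu T W F N : measurable_fun setT T ->
  measure_preserving mu T -> measurable W -> wandering T W ->
  measurable F ->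
  \sum_(0 <= n < N) mu (W `&` (iter n T @^-1` F)) <= mu F.
Proof.
move=> mT pT mW wW mF.
pose G n := (iter (N - n) T @^-1` W) `&` (iter N T @^-1` F).
have mG n : measurable (G n).
  by apply: measurableI; exact: measurable_preimage_iter.
have -> : \sum_(0 <= n < N) mu (W `&` (iter n T @^-1` F)) =
    \sum_(0 <= n < N) mu (G n).
  apply: eq_big_nat => n /andP[_ nN].
  rewrite -(@measure_preimage_iter mu T (N - n))//; last first.
    by apply: measurableI => //; exact: measurable_preimage_iter.
  congr (mu _); rewrite /G preimage_setI; congr (_ `&` _).
  by apply/seteqP; split=> x /=; rewrite -iterD subnKC// ltnW.
have key (i j : 'I_N) x : (i < j)%N -> G i x -> G j x -> False.
  move=> ij [/= Wi _] [/= Wj _]; apply: (wW _ (j - i)%N Wj).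
    by rewrite subn_gt0.
  rewrite -iterD; suff -> : (j - i + (N - j) = N - i)%N by [].
  by rewrite addnC addnBA 1?ltnW// subnK// ltnW.
have tG : trivIset [set: 'I_N] (fun i : 'I_N => G i).
  move=> i j _ _ [x [Gi Gj]]; case: (ltngtP i j) => [h|h|/val_inj//].
    by case: (key _ _ _ h Gi Gj).
  by case: (key _ _ _ h Gj Gi).
have -> : \sum_(0 <= n < N) mu (G n) = mu (\big[setU/set0]_(i < N) G i).
  rewrite big_mkord; apply/esym.
  exact: (@measure_bigsetU_ord _ _ _ mu N (fun=> true) (fun i : 'I_N => G i) (fun i => mG
    i) tG).
have <- := measure_preimage_iter N mT pT mF.
apply: le_measure; rewrite ?inE.
- by apply: bigsetU_measurable => i _.
- exact: measurable_preimage_iter.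
- by rewrite -(@bigcup_mkord _ N G) => x [n _] [].
Qed.

(** Borel-Cantelli: by [sum_visits_le] the measures of the sets [E n] have a sum at most [mu F], and
    the points in question lie in the lim sup of these sets. *)
Lemma finitely_many_visits mu T W F : measurable_fun setT T ->
  measure_preserving mu T -> measurable W -> wandering T W ->
  measurable F -> mu F < +oo ->
  mu.-negligible [set x | W x /\ forall N, exists2 n, (N <= n)%N & F (iter n T x)].
Proof.
move=> mT pT mW wW mF Foo.
pose E n := W `&` (iter n T @^-1` F).
have mE n : measurable (E n).
  by apply: measurableI => //; exact: measurable_preimage_iter.
exists (lim_sup_set E); split.
- by apply: bigcapT_measurable => n; apply: bigcup_measurable.
- apply: lim_sup_set_cvg0 => //; apply: le_lt_trans Foo.
  apply: lime_le; first by apply: is_cvg_nneseries.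
  by apply: nearW => N; exact: sum_visits_le.
- by move=> x [Wx h] N _; have [n Nn Fn] := h N; exists n.
Qed.

(** If visits to [B] occur but stop, the last one is at a point of [no_return T B]; by invariance
    the preimages of this null set are null. *)
Lemma infinitely_many_returns mu T B : measurable_fun setT T ->
  measure_preserving mu T -> mu.-negligible (no_return T B) ->
  mu.-negligible [set x | exists n, B (iter n T x) /\
    ~ forall N, exists2 n, (N <= n)%N & B (iter n T x)].
Proof.
move=> mT pT nB; apply: (@negligibleS _ _ _ _ (\bigcup_n (iter n T @^-1` no_return T B))).
  move=> x [n [Bn]] /existsNP[N hN]; apply: contrapT => hx; apply: hN.
  elim: N => [|N [m Nm Bm]]; first by exists n.
  have : ~ no_return T B (iter m T x) by move=> h; apply: hx; exists m.
  move=> /not_andP[//|/existsNP[k /not_implyP[k0 /contrapT Bk]]].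
  exists (k + m)%N; last by rewrite iterD.
  by rewrite -add1n leq_add.
by apply: negligible_bigcup => n; exact: negligible_preimage_iter.
Qed.

(** An orbit from [W] that meets [B] would almost surely meet it infinitely often, because [B] is
    recurrent, and finitely often, because [W] is wandering and [B] has finite measure. *)
Lemma wandering_meets_null mu T W B m : measurable_fun setT T ->
  measure_preserving mu T -> measurable W -> wandering T W ->
  measurable B -> mu B < +oo -> mu.-negligible (no_return T B) ->
  mu.-negligible (W `&` (iter m T @^-1` B)).
Proof.
move=> mT pT mW wW mB Boo nB.
have := negligibleU (finitely_many_visits mT pT mW wW mB Boo)
  (infinitely_many_returns mT pT nB).
apply: negligibleS => x [Wx Bx]; have [h|h] :=
  pselect (forall N, exists2 n, (N <= n)%N & B (iter n T x)); first by left.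
by right; exists m.
Qed.

(** Reduces recurrence of all measurable sets to that of countably many: any no-return set is
    wandering, hence meets each recurrent [M k] of finite measure in a null set. *)
Lemma conservative_cover mu T (M : (set X)^nat) : measurable_fun setT T ->
  measure_preserving mu T -> (forall k, measurable (M k)) ->
  (forall k, mu (M k) < +oo) -> mu (~` \bigcup_k M k) = 0 ->
  (forall k, mu.-negligible (no_return T (M k))) -> conservative mu T.
Proof.
move=> mT pT mM Moo M0 nM A mA.
have mW := measurable_no_return mT mA.
apply/negligibleP => //.
apply: (@negligibleS _ _ _ _ (~` (\bigcup_k M k) `|`
    \bigcup_k (no_return T A `&` (iter 0 T @^-1` M k)))).
  move=> x Wx; have [[k _ Mk]|] := pselect ((\bigcup_k M k) x); last by left.
  by right; exists k.
apply: negligibleU.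
  by apply/negligibleP => //; apply: measurableC; apply: bigcupT_measurable.
apply: negligible_bigcup => k; apply: wandering_meets_null => //.
exact: wandering_no_return.
Qed.

(* Almost every wandering orbit of T' visits the finite-measure set F only
   finitely often, hence ends up in V, where T' coincides with T. *)
Lemma conservative_modification mu mu' T T' (C : set X) (M : (set X)^nat) :
  measurable_fun setT T -> measurable_fun setT T' ->
  measure_preserving mu T -> measure_preserving mu' T' ->
  measurable C -> (forall A, measurable A -> A `<=` C -> mu A = mu' A) ->
  mu (~` C) < +oo -> mu' (~` C) < +oo ->
  (forall x, C x -> C (T x) -> C (T' x) -> T x = T' x) ->
  (forall k, measurable (M k)) -> (forall k, mu' (M k) < +oo) ->
  \bigcup_k M k = setT ->
  conservative mu T -> conservative mu' T'.
Proof.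
move=> mT mT' pT pT' mC muC Coo Coo' TT' mM Moo cM cT A mA.
have mpre (S : X -> X) E : measurable_fun setT S -> measurable E ->
    measurable (S @^-1` E) by move=> mS mE; rewrite -[_ @^-1` _]setTI; exact: mS.
have mW := measurable_no_return mT' mA.
have wW := @wandering_no_return T' A.
have mnC := measurableC mC.
(* Outside [F], a point and its images under both maps lie in [C], where the maps agree. The last
   piece is cut to [C] because its measure is bounded through [mu], which [T] preserves and which
   equals [mu'] only inside [C]. *)
pose F := ~` C `|` T' @^-1` (~` C) `|` (C `&` T @^-1` (~` C)).
have mF : measurable F.
  by apply: measurableU; [apply: measurableU|apply: measurableI] => //; exact: mpre.
have Foo : mu' F < +oo.
  apply: (@le_lt_trans _ _ (mu' (~` C) + mu' (T' @^-1` (~` C)) + mu' (C `&` T @^-1` (~`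
    C)))).
    apply: le_trans (measureU2 _ _ _) _ => //; first by apply: measurableU => //;
      exact: mpre.
      by apply: measurableI => //; exact: mpre.
    by rewrite leeD2r// measureU2//; exact: mpre.
  rewrite !lte_add_pinfty//; first by rewrite pT'.
  rewrite -muC; [|by apply: measurableI => //; exact: mpre|by move=> x []].
  apply: (@le_lt_trans _ _ (mu (T @^-1` (~` C)))); last by rewrite pT.
  by apply: measureIr => //; exact: mpre.
(* The points whose [T']-orbit avoids [F] for all time; from them the orbits under [T] and [T'] are
   the same. *)
pose V := \bigcap_n (iter n T' @^-1` (~` F)).
have mV : measurable V.
  by apply: bigcapT_measurable => n; apply: measurable_preimage_iter => //;
    exact: measurableC.
have VT x : V x -> V (T' x).
  by move=> Vx n _ /=; rewrite -iterSr; exact: Vx.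
have VC x : V x -> C x.
  by move=> /(_ 0%N I)/= nF; apply: contrapT => nC; apply: nF; left; left.
have VTT x : V x -> T x = T' x.
  move=> Vx; have Cx := VC _ Vx; apply: TT' => //; last exact/VC/VT.
  apply: contrapT => nC; apply: (Vx 0%N I); right; split => //.
have VTn x n : V x -> V (iter n T' x) /\ iter n T x = iter n T' x.
  by elim: n => // n IH Vx; have [/= ? ->] := IH Vx; rewrite VTT//; split => //; exact: VT.
pose B k := V `&` M k.
have mB k : measurable (B k) by apply: measurableI.
have Boo k : mu' (B k) < +oo.
  by apply: le_lt_trans (Moo k); exact: measureIr.
(* Inside [V] a return under [T] is a return under [T'], so the two no-return sets of [B k] are
   equal; they lie in [C], and conservativity of [T] carries over. *)
have nB k : mu'.-negligible (no_return T' (B k)).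
  have mN := measurable_no_return mT' (mB k).
  suff : mu' (no_return T' (B k)) = 0 by move=> ?; exact/negligibleP.
  rewrite -muC//; last by move=> x [[/VC]].
  rewrite -(cT _ (mB k)); congr (mu _); apply/seteqP.
  split=> x /= [Bx nr]; split=> // n n0; have [_ E] := VTn x n Bx.1.
    by rewrite E; exact: nr.
  by rewrite -E; exact: nr.
apply/negligibleP => //.
apply: (@negligibleS _ _ _ _ ([set x | no_return T' A x /\
    forall N, exists2 n, (N <= n)%N & F (iter n T' x)] `|`
   \bigcup_k \bigcup_m (no_return T' A `&` (iter m T' @^-1` B k)))).
  move=> x Wx.
  have [h|/existsNP[N hN]] :=
    pselect (forall N, exists2 n, (N <= n)%N & F (iter n T' x)); first by left.
  right; have VN : V (iter N T' x).
    move=> n _ /= Fn; apply: hN; exists (n + N)%N; rewrite ?leq_addl//.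
    by rewrite iterD.
  have [k _ Mk] : (\bigcup_k M k) (iter N T' x) by rewrite cM.
  by exists k => //; exists N.
apply: negligibleU; first exact: finitely_many_visits.
apply: negligible_bigcup => k; apply: negligible_bigcup => m.
exact: wandering_meets_null.
Qed.

End conservativity.

(** * Zero-one law for product laws *)

Section independence.
Context d (X : measurableType d) (R : realType) (Q : probability X R).
Local Open Scope ereal_scope.

(** For fixed [C] both sides are finite measures in [E], push-forwards by [f] of [Q] restricted to
    [C] and of a multiple of [Q]; they agree on a generating pi-system. *)
Lemma independent_pi_system (G : set (set X)) (f : X -> X) (C : set X) :
  measurable = <<s G >> -> setI_closed G -> G setT ->
  measurable_fun setT f -> measurable C ->
  (forall E, G E -> Q (f @^-1` E `&` C) = Q C * Q (f @^-1` E)) ->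
  forall E, measurable E -> Q (f @^-1` E `&` C) = Q C * Q (f @^-1` E).
Proof.
move=> mG GI GT mf mC GQ E mE.
have QC : Q C = (fine (Q C))%:E by rewrite fineK// fin_num_measure.
have c0 : (0 <= fine (Q C))%R by rewrite fine_ge0.
pose m1 : {measure set X -> \bar R} :=
  measure_function_pushforward__canonical__measure_function_Measure (mrestr Q mC) mf.
pose m2 : {measure set X -> \bar R} := mscale (NngNum c0)
  (measure_function_pushforward__canonical__measure_function_Measure Q mf).
suff : m1 E = m2 E by rewrite /m1 /m2 /= /mscale /= /pushforward /mrestr -QC.
apply: (measure_unique G (fun=> setT)) => //.
- by rewrite bigcup_const.
- by move=> A GA; rewrite /m1 /m2 /= /mscale /= /pushforward /mrestr -QC GQ.
- move=> _; rewrite /m1 /= /pushforward /mrestr preimage_setT setTI.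
  by apply: le_lt_trans (probability_le1 _ _) _ => //; rewrite ltry.
Qed.

End independence.

Section zero_one.
Context {R : realType} {d : measure_display} {Omega : measurableType d}.
Variables (P : probability Omega R) (Q : probability (gas_space Omega) R).
Hypothesis PQ : is_product_law P Q.
Implicit Types (l : gas_space Omega) (s : seq (int * int))
  (B : int * int -> set Omega).

Definition box s B : set (gas_space Omega) :=
  [set l | forall g, g \in s -> B g (l g)].

(** Unlike [cylinders], these sets are closed under intersection, and [is_product_law] gives their
    probability. *)
Definition boxes : set (set (gas_space Omega)) :=
  [set X | exists s B, [/\ uniq s, forall g, measurable (B g) & X = box s B]].

(** One common value for all cells of [s] suffices: the purpose is to forget what [l] was there. *)
Definition update s (w : Omega) l : gas_space Omega :=
  fun g => if g \in s then w else l g.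

Lemma measurable_coordinate g : measurable_fun setT (fun l => l g).
Proof.
move=> _ B mB; rewrite setTI; apply: sub_sigma_algebra.
by exists g, B.
Qed.

Lemma measurable_box s B : (forall g, measurable (B g)) -> measurable (box s B).
Proof.
move=> mB.
have -> : box s B = \bigcap_(g in [set` s]) ((fun l => l g) @^-1` B g) by [].
apply: fin_bigcap_measurable => [|g _]; first exact: finite_seq.
by rewrite -[_ @^-1` _]setTI; exact: measurable_coordinate.
Qed.

Lemma measurable_boxesE : measurable = <<s boxes >>.
Proof.
apply/seteqP; split.
  apply: (@smallest_sub _ _ cylinders); first exact: smallest_sigma_algebra.
  move=> _ [g [B [mB ->]]]; apply: (@sub_sigma_algebra _ setT boxes).
  exists [:: g], (fun=> B); split=> //.
  by apply/seteqP; split=> l /= h; [move=> g'; rewrite inE => /eqP ->|apply: h;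
    rewrite inE].
apply: smallest_sub; first exact: sigma_algebra_measurable.
by move=> _ [s [B [_ mB ->]]]; exact: measurable_box.
Qed.

Lemma boxI s s' B B' : box s B `&` box s' B' =
  box (undup (s ++ s')) (fun g => (if g \in s then B g else setT) `&`
                                  (if g \in s' then B' g else setT)).
Proof.
apply/seteqP; split=> l /=.
  by move=> [h h'] g _; split; case: ifP => // gs; [exact: h|exact: h'].
move=> h; split=> g gs; have := h g; rewrite mem_undup mem_cat gs ?orbT.
  by move=> /(_ isT)[].
by move=> /(_ isT)[].
Qed.

Lemma boxes_setI_closed : setI_closed boxes.
Proof.
move=> _ _ [s [B [us mB ->]]] [s' [B' [us' mB' ->]]].
exists (undup (s ++ s')); rewrite boxI; eexists; split; last reflexivity.
  exact: undup_uniq.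
by move=> g; apply: measurableI; case: ifP.
Qed.

Lemma boxes_setT : boxes setT.
Proof. by exists [::], (fun=> setT); split=> //; apply/seteqP; split. Qed.

Lemma measurable_update s w : measurable_fun setT (update s w).
Proof.
apply: (@measurability _ _ (gas_space Omega) (gas_space Omega) setT (update s w)
  (@cylinders _ Omega)) => //.
move=> _ [_ [g [B [mB ->]]] <-]; rewrite setTI.
have [gs|gs] := boolP (g \in s); last first.
  have -> : update s w @^-1` [set l | B (l g)] = (fun l => l g) @^-1` B.
    by apply/seteqP; split=> l; rewrite /= /update (negbTE gs).
  by rewrite -[_ @^-1` _]setTI; exact: measurable_coordinate.
have -> : update s w @^-1` [set l | B (l g)] = [set l | B w].
  by apply/seteqP; split=> l; rewrite /= /update gs.
have [Bw|nBw] := pselect (B w).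
  by rewrite (_ : [set l | B w] = setT)//; apply/seteqP; split.
by rewrite (_ : [set l | B w] = set0)//; apply/seteqP; split.
Qed.


(* The preimage of a box under [update s w] is a box over indices outside s,
   which is independent of a box over s. *)
Lemma independent_box_update s w B (E : set (gas_space Omega)) :
  uniq s -> (forall g, measurable (B g)) -> measurable E ->
  (Q (update s w @^-1` E `&` box s B) = Q (box s B) * Q (update s w @^-1` E))%E.
Proof.
move=> us mB; apply: (independent_pi_system measurable_boxesE boxes_setI_closed boxes_setT).
- exact: measurable_update.
- exact: measurable_box.
move=> _ [s' [B' [us' mB' ->]]].
(* Either [w] violates a constraint of the second box on a cell of [s], and the preimage is empty,
   or those constraints hold automatically and drop out. *)
have [hw|hw] := pselect (forall g, g \in s' -> g \in s -> B' g w); last first.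
  rewrite (_ : _ @^-1` _ = set0); first by rewrite set0I measure0 mule0.
  apply/seteqP; split=> // l /= h; apply: hw => g gs' gs.
  by have := h _ gs'; rewrite /update gs.
pose s1 := [seq g <- s' | g \notin s].
have -> : update s w @^-1` box s' B' = box s1 B'.
  apply/seteqP; split=> l /= h g.
    by rewrite mem_filter => /andP[gs /h]; rewrite /update (negbTE gs).
  move=> gs'; rewrite /update; case: ifPn => gs; first exact: hw.
  by apply: h; rewrite mem_filter gs.
have us1 : uniq s1 by rewrite filter_uniq.
pose B2 g := if g \in s then B g else B' g.
have -> : box s1 B' `&` box s B = box (s ++ s1) B2.
  apply/seteqP; split=> l /=.
    move=> [h1 h] g; rewrite mem_cat /B2; case: ifPn => gs /=; first by move=> _; exact: h.
    exact: h1.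
  move=> h; split=> g gs; have := h g; rewrite mem_cat gs ?orbT /B2 => /(_ isT).
    by move: gs; rewrite mem_filter => /andP[/negbTE ->].
  by rewrite gs.
rewrite !PQ//; last 2 first.
  rewrite cat_uniq us us1 andbT; apply/hasPn => g.
  by rewrite mem_filter => /andP[].
  by move=> g; rewrite /B2; case: ifP.
rewrite big_cat/=; congr (_ * _)%E; apply: eq_big_seq => g.
  by rewrite /B2 => ->.
by rewrite mem_filter /B2 => /andP[/negbTE ->].
Qed.

(** Being its own preimage under [update s w], the event is independent of every box over [s]. This
    holds for all finite [s], and boxes generate, so [E] is independent of itself. *)
Lemma kolmogorov_zero_one (E : set (gas_space Omega)) : measurable E ->
  (forall g w l, E (update [:: g] w l) <-> E l) ->
  (Q E = 0 \/ Q E = 1)%E.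
Proof.
move=> mE inv.
have invs s w l : E (update s w l) <-> E l.
  elim: s => [|g s IH]; first by rewrite (_ : update [::] w l = l).
  rewrite -IH -(inv g w (update s w l));
    rewrite (_ : update _ _ _ = update [:: g] w (update s w l))//.
  by apply/funext => h; rewrite /update !inE; case: eqP => //.
have QEE : (Q (E `&` E) = Q E * Q E)%E.
  apply: (@independent_pi_system _ _ _ Q boxes id E measurable_boxesE boxes_setI_closed
    boxes_setT) => //.
  move=> _ [s [B [us mB ->]]] /=; rewrite setIC muleC.
  rewrite -(_ : update s point @^-1` E = E); first exact: independent_box_update.
  by apply/seteqP; split=> l /= /invs.
move: QEE; rewrite setIid.
have -> : Q E = (fine (Q E))%:E by rewrite fineK// fin_num_measure.
rewrite -EFinM => -[] /eqP; rewrite -[X in X == _]mulr1 -subr_eq0 -mulrBr mulf_eq0.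
move=> /orP[/eqP ->|]; first by left.
by rewrite subr_eq0 => /eqP <-; right.
Qed.

Lemma measurable_completed (E : set (gas_space Omega)) : measurable E ->
  completed_algebra_gen Q E /\
  (@completed_measure_extension _ _ _ Q E = Q E).
Proof.
move=> mE; split.
  exists E => //; exists set0; first exact: negligible_set0.
  by rewrite setU0.
by rewrite /completed_measure_extension measurable_mu_extE.
Qed.

End zero_one.

(** * Change of variables on the line *)

Section density.
Context d (X : measurableType d) (R : realType) (mu : {measure set X -> \bar R}).
Variable (f : X -> R).
Hypotheses (mf : measurable_fun setT f) (f0 : forall x, 0 <= f x).
Local Open Scope ereal_scope.

(** The two proofs are arguments so that the measure structure can be attached to the term
    [density mf f0]. *)
Definition density of measurable_fun setT f & (forall x, (0 <= f x)%R) :=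
  fun A : set X => \int[mu]_(x in A) (f x)%:E.

Let density0 : density mf f0 set0 = 0.
Proof. by rewrite /density integral_set0. Qed.

Let density_ge0 A : 0 <= density mf f0 A.
Proof. by apply: integral_ge0 => x _; rewrite lee_fin. Qed.

Let density_sigma_additive : semi_sigma_additive (density mf f0).
Proof.
move=> F mF tF mUF; rewrite /density ge0_integral_bigcup//.
- by apply: is_cvg_ereal_nneg_natsum => n _; apply: integral_ge0 => x _; rewrite lee_fin.
- by apply/measurable_EFinP; exact: measurable_funS mf.
- by move=> x _; rewrite lee_fin.
Qed.

HB.instance Definition _ := isMeasure.Build _ _ _ (density mf f0)
  density0 density_ge0 density_sigma_additive.

End density.

Section image_measure.
Context {R : realType}.
Variables f f' : R -> R.
Hypotheses (df : forall x : R, is_derive x (1 : R) f (f' x)) (cf' : continuous f').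
Notation mu := (@lebesgue_measure R).

Let cf : continuous f.
Proof. by move=> x; apply: differentiable_continuous; apply/derivable1_diffP;
  exact: ex_derive. Qed.

(** By injectivity images commute with complements in the interval, so the sets with measurable
    image form a sigma-algebra; it contains the closed rays, whose traces on the interval are
    compact. *)
Lemma measurable_image_itv (a b : R) (E : set R) :
  {in `[a, b]%R &, injective f} -> measurable E -> E `<=` `[a, b]%classic ->
  measurable (f @` E).
Proof.
move=> fi mE Eab.
suff h : forall E, measurable E -> measurable (f @` (E `&` `[a, b]%classic)).
  by have := h _ mE; rewrite setIidl.
move=> {E mE Eab} E mE.
pose C := [set E : set R | measurable (f @` (E `&` `[a, b]%classic))].
suff : (@measurable _ (measurableTypeR R)) `<=` C by apply.
rewrite [X in X `<=` _]RGenCInfty.measurableE.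
have compC K : compact K -> measurable (f @` K).
  by move=> cK; apply: compact_measurable; apply: continuous_compact => //;
    exact: continuous_subspaceT.
have mab : measurable (f @` `[a, b]%classic) by apply: compC; exact: segment_compact.
apply: smallest_sub.
  split => /=.
  - by rewrite /C /= set0I image_set0.
  - move=> A CA; rewrite /C /=.
    rewrite (_ : f @` _ = f @` `[a, b]%classic `\` f @` (A `&` `[a, b]%classic));
      first exact: measurableD.
    apply/seteqP; split=> y /=.
      move=> [x [[_ nA] xab] <-]; split; first by exists x.
      by move=> [z [Az zab]] /fi; rewrite !inE => /(_ zab xab) zx; apply: nA; rewrite -zx.
    move=> [[x xab <-] nA]; exists x => //; split => //; split => // Ax.
    by apply: nA; exists x.
  - move=> F CF; rewrite /C /= setI_bigcupl image_bigcup.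
    by apply: bigcupT_measurable => n; exact: CF.
move=> _ [x ->] /=; apply: compC; rewrite setIC; apply: compact_closedI.
  exact: segment_compact.
exact: interval_closed.
Qed.

Let derf x : derive1 f x = f' x.
Proof. by rewrite derive1E; apply: derive_val. Qed.

(** Two measures on the image interval are compared: Lebesgue measure and the push-forward of the
    measure with density [f']. They agree on open rays by the fundamental theorem of calculus. *)
Lemma image_itv_integral (a b : R) : a < b ->
  (forall x, x \in `[a, b]%R -> 0 < f' x) ->
  forall E, measurable E -> E `<=` `[a, b]%classic ->
  measurable (f @` E) /\
  (mu (f @` E) = \int[mu]_(x in E) (f' x)%:E)%E.
Proof.
move=> ab f'0 E mE Eab.
have finc : {in `[a, b]%R &, {homo f : x y / x < y}}.
  apply: gtr0_derive1_lt_cc.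
  - by move=> x _.
  - by move=> x xab; rewrite derf; apply: f'0; exact: subset_itv_oo_cc.
  - exact: continuous_subspaceT.
have aab : a \in `[a, b]%R by rewrite in_itv/= lexx ltW.
have bab : b \in `[a, b]%R by rewrite in_itv/= lexx ltW.
have fi : {in `[a, b]%R &, injective f}.
  move=> x y xab yab fxy; case: (ltgtP x y) => // h.
    by have := finc _ _ xab yab h; rewrite fxy ltxx.
  by have := finc _ _ yab xab h; rewrite fxy ltxx.
have fle : {in `[a, b]%R &, {homo f : x y / x <= y}}.
  move=> x y xab yab; rewrite le_eqVlt => /orP[/eqP -> //|xy].
  exact/ltW/finc.
have mfE := measurable_image_itv fi mE Eab; split=> //.
have mf : measurable_fun setT (f : measurableTypeR R -> measurableTypeR R) by exact:
  continuous_measurable_fun.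
(* Equal to [f'] on the interval, and nonnegative everywhere as a density must be. *)
pose g x := Num.max 0 (f' x).
have mg : measurable_fun setT g.
  by apply: measurable_maxr => //; exact: continuous_measurable_fun.
have g0 x : 0 <= g x by rewrite /g le_max lexx.
have mab : measurable (`[a, b]%classic : set R) by [].
have gE F : F `<=` `[a, b]%classic -> (density mu mg g0 F = \int[mu]_(x in F) (f' x)%:E)%E.
  move=> Fab; apply: eq_integral => x /set_mem Fx; rewrite /g max_r// ltW// f'0//.
  exact: Fab.
have mfab : measurable (`[f a, f b]%classic : set R) by [].
pose m1 : {measure set (measurableTypeR R) -> \bar R} :=
  measure_function_pushforward__canonical__measure_function_Measure (mrestr (density mu mg
    g0) mab) mf.
pose m2 : {measure set (measurableTypeR R) -> \bar R} := mrestr mu mfab.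
suff H : m1 (f @` E) = m2 (f @` E).
  move: H; rewrite /m1 /m2 /= /pushforward /mrestr => H.
  have fE : f @^-1` (f @` E) `&` `[a, b]%classic = E.
    apply/seteqP; split=> x /=; last by move=> Ex; split; [exists x|exact: Eab].
    by move=> [[z Ez] /fi]; rewrite !inE => + xab => /(_ (Eab _ Ez) xab) <-.
  move: H; rewrite fE gE// => ->; congr (mu _); apply/esym/setIidl => _ [x /Eab xab <-] /=.
  rewrite in_itv/=; move: (xab); rewrite /= in_itv/= => /andP[ax xb].
  by rewrite !fle.
have FTC x : a < x -> x <= b -> (\int[mu]_(t in `[a, x]) (f' t)%:E = (f x - f a)%:E)%E.
  move=> ax xb; rewrite EFinB; apply: continuous_FTC2 => //.
  - exact: continuous_subspaceT.
  - split; first by move=> t _.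
      by apply: cvg_at_right_filter; exact: cf.
    by apply: cvg_at_left_filter; exact: cf.
have fab : f a < f b by exact: finc.
have m1E (B : set R) : measurable B ->
    m1 B = density mu mg g0 (f @^-1` B `&` `[a, b]%classic) by [].
have m1oo : (m1 setT < +oo)%E.
  by rewrite m1E// preimage_setT setTI gE// FTC// ltry.
apply: (@measure_unique _ R (measurableTypeR R) (@RGenInftyO.G R)
  (fun n => `]-oo, n%:R[%classic) _ _ _ _ m1 m2 _ _ _ mfE).
- exact: RGenInftyO.measurableE.
- move=> _ _ [x ->] [y ->]; exists (Num.min x y); apply/seteqP.
  by split=> z /=; rewrite !in_itv/= lt_min => /andP.
- by move=> n; exists n%:R.
- apply/seteqP; split=> // x _; exists (Num.truncn x).+1 => //=; rewrite in_itv/=.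
  exact: truncnS_gt.
- move=> _ [c ->]; rewrite m1E//.
  rewrite /m2 /= /mrestr.
  (* The ray ends before, inside or after the image interval; inside, its end point has a preimage
     by the intermediate value theorem. *)
  have [cfa|fac] := leP c (f a).
    rewrite (_ : _ `&` _ = set0); last first.
      apply/seteqP; split=> // x [] /=; rewrite !in_itv/= => fxc axb.
      have : f a <= f x by apply: fle => //; case/andP: axb.
      by rewrite leNgt (lt_le_trans fxc).
    rewrite (_ : _ `&` _ = set0) ?measure0//.
    apply/seteqP; split=> // x [] /=; rewrite !in_itv/= => xc /andP[fax _].
    by have := lt_le_trans xc (le_trans cfa fax); rewrite ltxx.
  have [cfb|fbc] := leP c (f b).
    have [x xab fx] : exists2 x, x \in `[a, b]%R & f x = c.
      apply: IVT; first exact: ltW.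
      - exact: continuous_subspaceT.
      - by rewrite ge_min le_max (ltW fac) cfb orbT.
    have ax : a < x.
      move: xab; rewrite in_itv/= le_eqVlt => /andP[/orP[/eqP ax|//] _].
      by move: fac; rewrite -fx -ax ltxx.
    have xb : x <= b by move: xab; rewrite in_itv/= => /andP[].
    rewrite (_ : _ `&` _ = `[a, x[%classic); last first.
      apply/seteqP; split=> z /=; rewrite !in_itv/= -fx.
        move=> [fzx /andP[az zb]]; rewrite az/= ltNge; apply/negP.
        rewrite le_eqVlt => /orP[/eqP xz|xz]; first by move: fzx; rewrite xz ltxx.
        have := finc _ _ xab _ xz; rewrite in_itv/= az zb => /(_ isT).
        by move=> /(lt_trans fzx); rewrite ltxx.
      move=> /andP[az zx]; rewrite az (ltW (lt_le_trans zx xb)); split=> //.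
      by apply: finc => //; rewrite in_itv/= az (ltW (lt_le_trans zx xb)).
    rewrite gE; last first.
      by move=> z /=; rewrite !in_itv/= => /andP[-> zx]; exact: ltW (lt_le_trans zx xb).
    rewrite integral_itv_bndo_bndc; last first.
      by apply/measurable_EFinP; apply: measurable_funTS; exact: continuous_measurable_fun.
    rewrite FTC// (_ : _ `&` _ = `[f a, c[%classic); last first.
      apply/seteqP; split=> z /=; rewrite !in_itv/=; first by move=> [-> /andP[-> _]].
      by move=> /andP[-> zc]; rewrite zc (ltW (lt_le_trans zc cfb)).
    by rewrite lebesgue_measure_itv/= lte_fin fac fx.
  rewrite (_ : _ `&` _ = `[a, b]%classic); last first.
    apply/seteqP; split=> [z []//|z zab]; split=> //=; rewrite in_itv/=.
    by apply: le_lt_trans fbc; apply: fle => //; move: zab; rewrite /= in_itv/= => /andP[].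
  rewrite gE// FTC// (_ : _ `&` _ = `[f a, f b]%classic); last first.
    apply/seteqP; split=> [z []//|z zab]; split=> //=; rewrite in_itv/=.
    by apply: le_lt_trans fbc; move: zab; rewrite /= in_itv/= => /andP[].
  by rewrite lebesgue_measure_itv/= lte_fin fab.
- by move=> n; apply: le_lt_trans m1oo; apply: le_measure; rewrite ?inE.
Qed.

(** By continuity [E] is covered by the countably many rational intervals on which [f'] is positive.
    They are made disjoint before the interval case is summed; injectivity on [E] keeps the images
    disjoint. *)
Lemma image_integral (E : set R) : measurable E -> (forall x, E x -> 0 < f' x) ->
  {in E &, injective f} ->
  measurable (f @` E) /\ (mu (f @` E) = \int[mu]_(x in E) (f' x)%:E)%E.
Proof.
move=> mE f'E fi.
pose good (pq : rat * rat) := ratr pq.1 < ratr pq.2 :> R /\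
  forall x, x \in `[ratr pq.1, ratr pq.2]%R -> 0 < f' x.
pose K n : set R := if unpickle n is Some pq then
    [set x | good pq /\ x \in `[ratr pq.1, ratr pq.2]%R] else set0.
have Kpickle pq : K (pickle pq) = [set x | good pq /\ x \in `[ratr pq.1, ratr pq.2]%R].
  by rewrite /K pickleK.
have KE n : K n = set0 \/ exists a b, [/\ a < b, (forall x, x \in `[a, b]%R -> 0 < f' x) &
  K n = `[a, b]%classic].
  rewrite /K; case: unpickle => [pq|]; last by left.
  have [gpq|ngpq] := pselect (good pq).
    by right; exists (ratr pq.1), (ratr pq.2); split;
      [exact: gpq.1|exact: gpq.2|apply/seteqP; split=> x /= => [[]|]].
  by left; apply/seteqP; split=> x // [].
have mK n : measurable (K n).
  by case: (KE n) => [->|[a [b [_ _ ->]]]].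
have EK : E `<=` \bigcup_n K n.
  move=> x /f'E f'x.
  have [e /= e0 he] : \forall y \near x, 0 < f' y.
    have := @cf' x; move/cvgr_gt; exact.
  have [p] := @rat_in_itvoo R (x - e) x ltac:(by rewrite ltrBlDr ltrDl).
  have [q] := @rat_in_itvoo R x (x + e) ltac:(by rewrite ltrDl).
  rewrite !in_itv/= => /andP[xq qe] /andP[ep px].
  exists (pickle (p, q)); first exact: I.
  rewrite Kpickle /= in_itv/= (ltW px) (ltW xq); split=> //.
  split=> /=; first exact: lt_trans xq.
  move=> y; rewrite in_itv/= => /andP[py yq]; apply: he => /=.
  rewrite distrC ltr_distl (lt_le_trans ep py)/=.
  exact: le_lt_trans yq qe.
pose En n := E `&` seqDU K n.
have mEn n : measurable (En n) by apply: measurableI => //; exact: seqDU_measurable.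
have tEn : trivIset setT En by apply: trivIset_setIl; exact: trivIset_seqDU.
have EE : E = \bigcup_n En n.
  by rewrite -setI_bigcupr -seqDU_bigcup_eq; apply/esym/setIidl.
have imEn n : measurable (f @` En n) /\ (mu (f @` En n) = \int[mu]_(x in En n) (f' x)%:E)%E.
  have sub : En n `<=` K n by move=> x [_ []].
  case: (KE n) => [K0|[a [b [ab f'ab Kab]]]].
    have -> : En n = set0 by apply/seteqP; split=> // x /sub; rewrite K0.
    by rewrite image_set0 measure0 integral_set0; split.
  by apply: (image_itv_integral ab) => //; rewrite -Kab.
rewrite {1 2}EE image_bigcup; split.
  by apply: bigcupT_measurable => n; case: (imEn n).
rewrite measure_semi_bigcup//=; last 3 first.
- by move=> n; case: (imEn n).
- move=> i j _ _ [_ [[x Eix <-] [y Ejy fxy]]].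
  have := fi y x; rewrite !inE => /(_ Ejy.1 Eix.1 fxy) yx.
  by apply: tEn => //; exists x; split=> //; rewrite -yx.
- by apply: bigcupT_measurable => n; case: (imEn n).
rewrite EE ge0_integral_bigcup//.
- by apply: eq_eseriesr => n _; case: (imEn n).
- by apply/measurable_EFinP; apply: measurable_funTS; exact: continuous_measurable_fun.
- by move=> x [n _ [Ex _]]; rewrite lee_fin ltW//; exact: f'E.
Qed.

End image_measure.

(** * Plane vectors and convexity *)

Section plane_algebra.
Context {R : realType}.
Implicit Types u v w : R * R.

Lemma crossDr u v w : cross u (v + w) = cross u v + cross u w.
Proof. by rewrite /cross /=; ring. Qed.

Lemma crossBr u v w : cross u (v - w) = cross u v - cross u w.
Proof. by rewrite /cross /=; ring. Qed.

Lemma crossZr u v (t : R) : cross u (t *: v) = t * cross u v.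
Proof. by rewrite /cross /= /GRing.scale /=; ring. Qed.

Lemma crossNr u v : cross u (- v) = - cross u v.
Proof. by rewrite /cross /=; ring. Qed.

Lemma crossNl u v : cross (- u) v = - cross u v.
Proof. by rewrite /cross /=; ring. Qed.

Lemma crossC u v : cross u v = - cross v u.
Proof. by rewrite /cross /=; ring. Qed.

Lemma cross_same u : cross u u = 0.
Proof. by rewrite /cross; ring. Qed.

Lemma dot_cross_sqr u v :
  dot u v ^+ 2 + cross u v ^+ 2 = dot u u * dot v v.
Proof. by rewrite /dot /cross; ring. Qed.

Lemma cross_colinear u v w : cross u w != 0 -> cross w v = 0 ->
  v = (cross u v / cross u w) *: w.
Proof.
move=> uw0 wv0; apply/eqP; rewrite eq_sym -subr_eq0 -[X in _ == X](scaler0 _ (cross u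
  w)^-1).
have -> : (cross u v / cross u w) *: w - v =
    (cross u w)^-1 *: (cross u v *: w - cross u w *: v).
  by rewrite scalerBr !scalerA mulVf// scale1r mulrC.
apply/eqP; congr (_ *: _).
have -> : cross u v *: w - cross u w *: v = cross w v *: u.
  by rewrite [LHS]surjective_pairing [RHS]surjective_pairing; congr pair;
    rewrite /cross /= /GRing.scale /=; ring.
by rewrite wv0 scale0r.
Qed.

Lemma unit_decomposition u v : dot u u = 1 ->
  v = dot u v *: u + cross u v *: perp u.
Proof.
move=> u1; rewrite [LHS]surjective_pairing [RHS]surjective_pairing.
by congr pair; rewrite -[LHS]mulr1 -u1 /dot /cross /perp /= /GRing.scale /=; ring.
Qed.

Lemma unit_eq u v : dot u u = 1 -> dot v v = 1 -> cross u v = 0 ->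
  v = u \/ v = - u.
Proof.
move=> u1 v1 uv0; have := dot_cross_sqr u v.
rewrite u1 v1 uv0 expr0n addr0 mulr1 => /eqP; rewrite sqrf_eq1.
have := unit_decomposition v u1; rewrite uv0 scale0r addr0 => vE.
by move=> /orP[|]/eqP d; rewrite vE d; [left; rewrite scale1r|right; rewrite scaleN1r].
Qed.

Lemma reflect_alongK u v : dot u u = 1 ->
  reflect_along u (reflect_along u v) = v.
Proof.
move=> u1; rewrite (unit_decomposition v u1) /reflect_along.
set a := dot u v; set b := cross u v.
have E : dot (a *: u + b *: perp u) u = a.
  by rewrite -[RHS]mulr1 -u1 /dot /perp /= /GRing.scale /=; ring.
rewrite E; set w := a *: u + b *: perp u.
have -> : dot ((2 * a) *: u - w) u = a.
  have -> : dot ((2 * a) *: u - w) u = 2 * a * dot u u - dot w u.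
    by rewrite /dot /= /GRing.scale /=; ring.
  by rewrite E u1; ring.
by rewrite opprB addrCA subrr addr0.
Qed.

Lemma cross_reflect_along u v : cross u (reflect_along u v) = - cross u v.
Proof. by rewrite /reflect_along crossBr crossZr cross_same mulr0 sub0r. Qed.

Lemma dot_reflect_along u v : dot u u = 1 ->
  dot (reflect_along u v) (reflect_along u v) = dot v v.
Proof.
move=> u1.
have -> : dot (reflect_along u v) (reflect_along u v) =
    4 * dot v u ^+ 2 * (dot u u - 1) + dot v v.
  by rewrite /reflect_along /dot /= /GRing.scale /=; ring.
by rewrite u1 subrr mulr0 add0r.
Qed.

Lemma reflect_alongN u v : reflect_along u (- v) = - reflect_along u v.
Proof.
rewrite [LHS]surjective_pairing [RHS]surjective_pairing /reflect_along.
by congr pair; rewrite /dot /= /GRing.scale /=; ring.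
Qed.

Lemma cross_perpD u v w : cross u (perp (v + w)) = dot u v + dot u w.
Proof. by rewrite /cross /dot /perp /=; ring. Qed.

Lemma dot_Nperp u : dot (- perp u) (- perp u) = dot u u.
Proof. by rewrite /dot /perp /=; ring. Qed.

Lemma cross_Nperp u : cross u (- perp u) = - dot u u.
Proof. by rewrite /cross /dot /perp /=; ring. Qed.

Lemma dotC u v : dot u v = dot v u.
Proof. by rewrite /dot; ring. Qed.

Lemma unit_opp u v : dot u u = 1 -> dot v v = 1 -> dot u v = -1 -> v = - u.
Proof.
move=> u1 v1 uv; have := dot_cross_sqr u v; rewrite u1 v1 uv mulr1 sqrrN expr1n.
move=> /eqP; rewrite -subr_eq0 addrAC subrr add0r sqrf_eq0 => /eqP c0.
by rewrite (unit_decomposition v u1) c0 uv scale0r addr0 scaleN1r.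
Qed.

Lemma dot_unit_norm_le1 u v : dot u u = 1 -> dot v v = 1 -> `|dot u v| <= 1.
Proof.
move=> u1 v1; have := dot_cross_sqr u v; rewrite u1 v1 mulr1 => E.
rewrite -(@ler_pXn2r _ 2)// ?nnegrE// expr1n real_normK ?num_real//.
by rewrite -E lerDl sqr_ge0.
Qed.

Lemma line_reverse (p v : R * R) (s t : R) :
  p + t *: v + s *: (- v) = p + (t - s) *: v.
Proof. by rewrite scalerN scalerBl addrA. Qed.

End plane_algebra.

Section open_convex.
Context {R : realType}.
Implicit Types (A : set (R * R)) (p q : R * R).

Lemma convex_segment A p q (t : R) :
  convex_set (A : set (convex_lmodType (R * R)%type)) ->
  A p -> A q -> 0 <= t -> t <= 1 -> A (t *: p + (1 - t) *: q).
Proof.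
move=> cA Ap Aq t0 t1.
have := cA p q (Itv01 t0 t1); rewrite !inE => /(_ Ap Aq).
by rewrite /conv /=.
Qed.

(** Replace [q] by a nearby [q'] of [A] and move [p] so that the combination does not change; the
    moved point [f q'] is still in [A] because [A] is open. *)
Lemma open_convex_segment A p q (t : R) : open A ->
  convex_set (A : set (convex_lmodType (R * R)%type)) ->
  A p -> closure A q -> 0 < t -> t <= 1 -> A (t *: p + (1 - t) *: q).
Proof.
move=> oA cA Ap Aq t0 t1.
pose f q' := p + ((1 - t) / t) *: (q - q').
have fc : f q' @[q' --> q] --> p.
  have -> : nbhs p = nbhs (p + ((1 - t) / t) *: (q - q)).
    by rewrite subrr scaler0 addr0.
  apply: cvgD; first exact: cvg_cst.
  apply: cvgZ; first exact: cvg_cst.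
  by apply: cvgB; [exact: cvg_cst|exact: cvg_id].
have [q' [Aq' Afq']] : A `&` (f @^-1` A) !=set0.
  by apply: Aq; apply: fc; exact: open_nbhs_nbhs.
have -> : t *: p + (1 - t) *: q = t *: f q' + (1 - t) *: q'.
  rewrite /f scalerDr scalerA mulrCA divff ?gt_eqF// mulr1 scalerBr.
  by rewrite -!addrA addNr addr0.
by apply: convex_segment => //; exact: ltW.
Qed.

End open_convex.

(** * Geometry of one scatterer *)

Section pair_derivative.
Context {R : realType}.

Lemma fst_continuous : continuous (fst : R * R -> R).
Proof. by move=> p; exact: (@cvg_fst _ _ (nbhs p.1) (nbhs p.2)). Qed.

Lemma snd_continuous : continuous (snd : R * R -> R).
Proof. by move=> p; exact: (@cvg_snd _ _ (nbhs p.1) (nbhs p.2)). Qed.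

Implicit Types (f : R -> R * R) (x : R).

Lemma derivable_pair_cvg f x : derivable f x 1 ->
  h^-1 *: ((f \o shift x) (h *: 1) - f x) @[h --> 0^'] --> derive1 f x.
Proof. by move=> df; rewrite derive1E. Qed.

Lemma is_derive_fst f x : derivable f x 1 ->
  is_derive x (1 : R) (fun y => (f y).1) (derive1 f x).1.
Proof.
move=> /derivable_pair_cvg h.
have h1 : h^-1 *: (((fun y => (f y).1) \o shift x) (h *: (1 : R)) - (f x).1) @[h --> 0^']
  -->
    (derive1 f x).1.
  exact: (cvg_comp _ _ h (@fst_continuous _)).
by split; [apply/cvg_ex; exists (derive1 f x).1|apply: cvg_lim].
Qed.

Lemma is_derive_snd f x : derivable f x 1 ->
  is_derive x (1 : R) (fun y => (f y).2) (derive1 f x).2.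
Proof.
move=> /derivable_pair_cvg h.
have h1 : h^-1 *: (((fun y => (f y).2) \o shift x) (h *: (1 : R)) - (f x).2) @[h --> 0^']
  -->
    (derive1 f x).2.
  exact: (cvg_comp _ _ h (@snd_continuous _)).
by split; [apply/cvg_ex; exists (derive1 f x).2|apply: cvg_lim].
Qed.

Lemma is_derive_cross f x (w : R * R) : derivable f x 1 ->
  is_derive x (1 : R) (fun y => cross w (f y)) (cross w (derive1 f x)).
Proof.
move=> df; have := is_derive_fst df; have := is_derive_snd df => d2 d1.
rewrite /cross.
have -> : (fun y => w.1 * (f y).2 - w.2 * (f y).1) =
   (w.1 *: (fun y => (f y).2)) - (w.2 *: (fun y => (f y).1)) by [].
exact: is_deriveB.
Qed.

Lemma cross_continuous (T : topologicalType) (w : R * R) (f : T -> R * R) : continuous f ->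
  continuous (fun r => cross w (f r)).
Proof.
move=> cf r; rewrite /cross; apply: cvgB; apply: cvgM; try exact: cvg_cst.
  exact: (cvg_comp _ _ (@cf r) (@snd_continuous _)).
exact: (cvg_comp _ _ (@cf r) (@fst_continuous _)).
Qed.

(** Multiplied by [c], the difference quotient tends to [c * c > 0], so [g] has opposite signs at
    two points symmetric about [x] and as close to it as [P] demands. *)
Lemma derive_sign_change (g : R -> R) x (c : R) : is_derive x (1 : R) g c -> c != 0 -> g x
  = 0 ->
  forall P : R -> Prop, (\forall h \near (0 : R), P h) ->
  exists h k, [/\ P h, P k, 0 < g (x + h) & g (x + k) < 0].
Proof.
move=> [dg gc] c0 gx P P0.
have cv : h^-1 *: ((g \o shift x) (h *: (1 : R)) - g x) * c @[h --> 0^'] --> c * c.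
  by apply: cvgM; [rewrite -gc; exact: dg|exact: cvg_cst].
have : \forall h \near 0^', 0 < h^-1 *: ((g \o shift x) (h *: (1 : R)) - g x) * c.
  by move/cvgr_gt : cv; apply; rewrite -expr2 exprn_even_gt0.
move=> [e1 /= e10 h1]; move: P0 => [e2 /= e20 h2].
pose e := Num.min e1 e2 / 2.
have e0 : 0 < e by rewrite divr_gt0// lt_min e10.
have ee : e < Num.min e1 e2 by rewrite ltr_pdivrMr// ltr_pMr ?ltr1n// lt_min e10.
move: ee; rewrite lt_min => /andP[ee1 ee2].
have key h : `|h| = e -> P h /\ 0 < h^-1 * g (x + h) * c.
  move=> he; split; first by apply: h2; rewrite /= sub0r normrN he.
  have := h1 h; rewrite /= sub0r normrN he => /(_ ee1).
  rewrite -normr_gt0 he => /(_ e0); rewrite gx subr0.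
  by rewrite {2}/GRing.scale /= mulr1 addrC.
have [Pe ge] := key e (gtr0_norm e0).
have [Pne gne] : P (- e) /\ 0 < (- e)^-1 * g (x - e) * c.
  by apply: key; rewrite normrN gtr0_norm.
move: ge gne; rewrite invrN !mulNr oppr_gt0 -!mulrA pmulr_rgt0 ?invr_gt0//.
rewrite pmulr_rlt0 ?invr_gt0//. 
case: (ltgtP c 0) c0 => // cs _.
  by rewrite nmulr_lgt0// nmulr_llt0// => ? ?; exists (- e), e.
by rewrite pmulr_lgt0// pmulr_llt0// => ? ?; exists e, (- e).
Qed.

End pair_derivative.

Section scatterer_geometry.
Context {R : realType}.
Variable S : scatterer R.
Hypothesis HS : is_scatterer S.
Local Notation u := (tangent S).
Local Notation b := (bdry S).

Lemma bdry_derivable r : derivable b r 1.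
Proof. by have [+ _] := bdry_C3 HS; move=> /(_ 0%N isT r). Qed.

Lemma bdry_is_derive_cross (w : R * R) r :
  is_derive r (1 : R) (fun y => cross w (b y)) (cross w (u r)).
Proof. exact/is_derive_cross/bdry_derivable. Qed.

Lemma tangent_continuous : continuous u.
Proof.
have [+ _] := bdry_C3 HS; move=> /(_ 1%N isT) h r.
by apply: differentiable_continuous; apply/derivable1_diffP; exact: h.
Qed.

Lemma bdry_boundary r : r \in `[0, perim S[%R -> closure (body S) (b r) /\ ~ body S (b r).
Proof.
move=> rS; have : (closure (body S) `\` body S) (b r).
  by rewrite -(bdry_image HS); exists r.
by [].
Qed.

Lemma boundary_bdry p : closure (body S) p -> ~ body S p ->
  exists2 r, r \in `[0, perim S[%R & b r = p.
Proof.
move=> cp np; have : (closure (body S) `\` body S) p by [].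
by rewrite -(bdry_image HS) => -[r rS <-]; exists r.
Qed.

(** A parameter that leaves the fundamental interval by less than one perimeter is brought back by
    periodicity. *)
Lemma bdry_closure_near r : r \in `[0, perim S[%R ->
  \forall h \near (0 : R), closure (body S) (b (r + h)).
Proof.
rewrite in_itv/= => /andP[r0 rL]; have L0 := perim_gt0 HS.
exists (perim S) => //= h /=; rewrite sub0r normrN ltr_norml => /andP[Lh hL].
have [rh0|rh0] := ltP (r + h) 0.
  rewrite -(bdry_periodic HS); apply: (bdry_boundary _).1.
  by rewrite in_itv/=; apply/andP; split; lra.
have [rhL|rhL] := ltP (r + h) (perim S).
  by apply: (bdry_boundary _).1; rewrite in_itv/= rh0.
rewrite -(subrK (perim S) (r + h)) (bdry_periodic HS); apply: (bdry_boundary _).1.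
by rewrite in_itv/=; apply/andP; split; lra.
Qed.

Lemma body_nonempty : body S !=set0.
Proof.
have : closure (body S) (b 0).
  by apply: (bdry_boundary _).1; rewrite in_itv/= lexx (perim_gt0 HS).
by move=> /(_ setT filterT)[p [Sp _]]; exists p.
Qed.

Lemma tangent_unit r : dot (u r) (u r) = 1.
Proof. exact: bdry_unit_speed. Qed.

Lemma closure_left r p : closure (body S) p -> 0 <= cross (u r) (p - b r).
Proof.
move=> cp; rewrite leNgt; apply/negP => hlt.
have fc : cross (u r) (q - b r) @[q --> p] --> cross (u r) (p - b r).
  by apply: (@cross_continuous R (R * R)%type (u r) (fun q => q - b r)) => q; apply: cvgB;
    [exact: cvg_id|exact: cvg_cst].
have : \forall q \near p, cross (u r) (q - b r) < 0.
  by move/cvgr_lt : fc; exact.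
by move=> /cp[q [/(bdry_ccw HS r) + /lt_trans h]] => /h; rewrite ltxx.
Qed.

(** The converse of [bdry_ccw] near a boundary point. The boundary curve crosses the line through
    [b r] of direction [w], so the closure has points strictly on both sides of it; joining a
    suitable one to an interior point gives an interior point on this line, and it lies on the
    inward half by [bdry_ccw]. *)
Lemma bdry_inward r w : r \in `[0, perim S[%R -> 0 < cross (u r) w ->
  exists2 s0, 0 < s0 & forall s, 0 < s -> s <= s0 -> body S (b r + s *: w).
Proof.
move=> rS uw.
(* One interior point on the ray is enough, by convexity of the segment down to [b r]. *)
suff [s0 s00 h] : exists2 s0, 0 < s0 & body S (b r + s0 *: w).
  exists s0 => // s sp ss0.
  have := open_convex_segment (body_open HS) (body_convex HS) h (bdry_boundary rS).1
    (divr_gt0 sp s00).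
  rewrite ler_pdivrMr// mul1r => /(_ ss0).
  rewrite scalerDr scalerA divfK ?gt_eqF// scalerBl scale1r addrAC addrCA.
  by rewrite subrr addr0 addrC.
have [p0 Sp0] := body_nonempty.
pose g y := cross w (b y - b r).
have dg : is_derive r (1 : R) g (cross w (u r)).
  rewrite /g; under eq_fun do rewrite crossBr.
  rewrite -[X in is_derive _ _ _ X]subr0.
  by apply: is_deriveB; exact: bdry_is_derive_cross.
have wu : cross w (u r) != 0 by rewrite crossC oppr_eq0 gt_eqF.
have g0 : g r = 0 by rewrite /g subrr /cross /= !mulr0 subr0.
have [h [k [Ph Pk gh gk]]] := derive_sign_change dg wu g0 (bdry_closure_near rS).
(* A point strictly off the line, on the side that does not contain [p0]. *)
have [y [cy c1 c10]] : exists y, [/\ closure (body S) y, cross w (y - b r) != 0 &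
    cross w (y - b r) * cross w (p0 - b r) <= 0].
  have [c0|c0] := leP (cross w (p0 - b r)) 0.
    by exists (b (r + h)); split=> //; [rewrite gt_eqF|rewrite mulr_ge0_le0// ltW].
  exists (b (r + k)); split=> //; [by rewrite lt_eqF|].
  by rewrite mulr_le0_ge0// ltW.
set a1 := cross w (y - b r) in c1 c10; set a0 := cross w (p0 - b r) in c10.
have a10 : a1 - a0 != 0.
  by apply: contra c1 => /eqP h0;
    rewrite -sqrf_eq0 eq_le sqr_ge0 andbT expr2 -{2}(subrK a0 a1) h0 add0r.
(* The weight that puts the combination of [p0] and [y] on the line. *)
pose t := a1 / (a1 - a0).
have t0 : 0 < t.
  have -> : t = a1 ^+ 2 / (a1 ^+ 2 - a1 * a0) by rewrite expr2 -mulrBr -mulf_div divff//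
    mul1r.
  apply: divr_gt0; first by rewrite exprn_even_gt0.
  by rewrite (@lt_le_trans _ _ (a1 ^+ 2))// ?exprn_even_gt0// lerDl oppr_ge0.
have t1 : t <= 1.
  have -> : t = a1 ^+ 2 / (a1 ^+ 2 - a1 * a0) by rewrite expr2 -mulrBr -mulf_div divff//
    mul1r.
  have a12 : 0 < a1 ^+ 2 by rewrite exprn_even_gt0.
  by rewrite ler_pdivrMr ?mul1r ?lerDl ?oppr_ge0//; lra.
have Sm := open_convex_segment (body_open HS) (body_convex HS) Sp0 cy t0 t1.
set m := _ + _ in Sm.
have wm : cross w (m - b r) = 0.
  have -> : m - b r = t *: (p0 - b r) + (1 - t) *: (y - b r).
    rewrite /m; rewrite [LHS]surjective_pairing [RHS]surjective_pairing.
    by congr pair; rewrite /= /GRing.scale /=; ring.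
  by rewrite crossDr !crossZr -/a0 -/a1 /t; field.
have um := bdry_ccw HS r Sm.
exists (cross (u r) (m - b r) / cross (u r) w); first exact: divr_gt0.
by rewrite -(cross_colinear (lt0r_neq0 uw) wm) addrC subrK.
Qed.

End scatterer_geometry.

(** * Collisions *)

Section coordinates.
Context {R : realType}.
Implicit Types (z : R * R).

(** Time reversal: the particle leaves [reverse z] with the opposite of the velocity with which it
    arrived at the collision recorded by [z]. *)
Definition reverse z : R * R := (z.1, pi - z.2).

Lemma reverseK z : reverse (reverse z) = z.
Proof. by case: z => r phi; rewrite /reverse/= subKr. Qed.

Variable S : scatterer R.
Hypothesis HS : is_scatterer S.
Local Notation u := (tangent S).

Lemma coordinatesP z : coordinates S z <->
  z.1 \in `[0, perim S[%R /\ 0 <= z.2 <= pi.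
Proof. by rewrite /coordinates /= in_itv. Qed.

Lemma coordinates_reverse z : coordinates S z -> coordinates S (reverse z).
Proof.
move=> /coordinatesP[z1 /andP[p0 ppi]]; apply/coordinatesP; split=> //=.
by rewrite subr_ge0 ppi/= gerBl.
Qed.

Lemma dot_velocity z : dot (u z.1) (velocity S z) = - cos z.2.
Proof.
have -> : dot (u z.1) (velocity S z) = - cos z.2 * dot (u z.1) (u z.1).
  by rewrite /velocity /dot /perp /= /GRing.scale /=; ring.
by rewrite tangent_unit// mulr1.
Qed.

Lemma cross_velocity z : cross (u z.1) (velocity S z) = - sin z.2.
Proof.
have -> : cross (u z.1) (velocity S z) = - sin z.2 * dot (u z.1) (u z.1).
  by rewrite /velocity /cross /dot /perp /= /GRing.scale /=; ring.
by rewrite tangent_unit// mulr1.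
Qed.

Lemma velocity_unit z : dot (velocity S z) (velocity S z) = 1.
Proof.
have := dot_cross_sqr (u z.1) (velocity S z).
by rewrite dot_velocity cross_velocity tangent_unit// mul1r !sqrrN cos2Dsin2 => <-.
Qed.

Lemma velocity_reverse z :
  velocity S (reverse z) = - reflect_along (u z.1) (velocity S z).
Proof.
rewrite [RHS](unit_decomposition _ (tangent_unit HS z.1)) crossNr.
rewrite cross_reflect_along opprK cross_velocity.
have -> : dot (u z.1) (- reflect_along (u z.1) (velocity S z)) = cos z.2.
  rewrite /reflect_along opprB.
  have -> (a : R) : dot (u z.1) (velocity S z - a *: u z.1) =
      dot (u z.1) (velocity S z) - a * dot (u z.1) (u z.1).
    by rewrite /dot /= /GRing.scale /=; ring.
  rewrite tangent_unit// (_ : dot (velocity S z) _ = dot (u z.1) (velocity S z));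
    last first.
    by rewrite /dot; ring.
  by rewrite dot_velocity; ring.
have sinE : sin (pi - z.2) = sin z.2 by rewrite sinB sinpi cospi; ring.
have cosE : cos (pi - z.2) = - cos z.2 by rewrite cosB sinpi cospi; ring.
by rewrite /velocity /reverse/= sinE cosE opprD -!scaleNr opprK.
Qed.

(** The components of a velocity along the tangent and its normal are minus the cosine and the sine
    of the angle; an outward [v] has nonnegative sine, so the angle in [0, pi] is given by its
    cosine. *)
Lemma velocity_surj r v : r \in `[0, perim S[%R -> dot v v = 1 ->
  cross (u r) v <= 0 ->
  coordinates S (r, acos (- dot (u r) v)) /\ velocity S (r, acos (- dot (u r) v)) = v.
Proof.
move=> rS v1 cv; have E := dot_cross_sqr (u r) v.
rewrite tangent_unit// v1 mulr1 in E.
have d1 : -1 <= - dot (u r) v <= 1.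
  by rewrite -ler_norml normrN dot_unit_norm_le1// tangent_unit.
split; first by apply/coordinatesP; split=> //=; rewrite acos_ge0// acos_lepi.
rewrite [RHS](unit_decomposition _ (tangent_unit HS r)) /velocity/=.
rewrite acosK// sin_acos// sqrrN.
rewrite (_ : 1 - dot (u r) v ^+ 2 = cross (u r) v ^+ 2); last by rewrite -E; ring.
by rewrite sqrtr_sqr ler0_norm// opprD -!scaleNr !opprK.
Qed.

Lemma velocity_inj z z' : coordinates S z -> coordinates S z' ->
  z.1 = z'.1 -> velocity S z = velocity S z' -> z = z'.
Proof.
move=> /coordinatesP[_ c] /coordinatesP[_ c'] z1 vE.
have /eqP := dot_velocity z; rewrite vE z1 dot_velocity eqr_opp => /eqP/esym/cos_inj h.
by rewrite (surjective_pairing z) (surjective_pairing z') z1 h// in_itv/=.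
Qed.

Lemma acos_velocity z : coordinates S z -> acos (- dot (u z.1) (velocity S z)) = z.2.
Proof.
by move=> /coordinatesP[_ c]; rewrite dot_velocity opprK cosK.
Qed.

End coordinates.

(** * Existence, uniqueness and reversibility of collisions *)

Section collisions.
Context {R : realType} {I : pointedType}.
Variable G : gas R I.
Hypotheses (HG : lorentz_gas G) (SA : standing_assumption G).
Implicit Types (x y : phase R I) (q v : R * R).

Let scat i S : G i = Some S -> is_scatterer S := @gas_scatterer _ _ _ HG i S.

Lemma next_hit i S z : G i = Some S -> coordinates S z ->
  exists t, first_hit G (position S z) (velocity S z) t.
Proof.
move=> GS cz; have [km [kM [tm [tM [_ _ h]]]]] := SA.
by have [t ft _] := h _ _ _ GS cz; exists t.
Qed.

(** The uniform lower bound on free paths, in the form that forbids a second scatterer to touch the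
    one being left. *)
Lemma hit_bounded_below : exists2 tm, 0 < tm & forall i S z s,
  G i = Some S -> coordinates S z -> 0 < s -> s < tm ->
  ~ obstacles G (position S z + s *: velocity S z).
Proof.
have [km [kM [tm [tM [[_ _ tm0 _] _ h]]]]] := SA.
exists tm => // i S z s GS cz s0 stm.
have [t [_ _ free] /andP[tmt _]] := h _ _ _ GS cz.
by apply: free => //; exact: lt_le_trans tmt.
Qed.

Lemma first_hit_inj q v t t' : first_hit G q v t -> first_hit G q v t' -> t = t'.
Proof.
move=> [t0 Ot ft] [t0' Ot' ft']; case: (ltgtP t t') => // h.
  by case: (ft' _ t0 h).
by case: (ft _ t0' h).
Qed.

(** Just before a first hit the particle is outside the body. So the hit point is not interior, and
    [v] cannot point strictly outward there: the backward ray would be inside by [bdry_inward]. *)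
Lemma hit_boundary q v t j S : first_hit G q v t -> G j = Some S ->
  closure (body S) (q + t *: v) ->
  exists r, [/\ r \in `[0, perim S[%R, bdry S r = q + t *: v & 0 <= cross (tangent S r) v].
Proof.
move=> [t0 _ free] GS clS.
have HS := scat GS.
have back s : 0 < s -> s < t -> ~ body S (q + t *: v + s *: (- v)).
  move=> s0 st Sp; apply: (free (t - s)); rewrite ?subr_gt0// ?gtrBl//.
  exists j, S; split=> //; apply: subset_closure.
  by rewrite scalerBl addrA -scalerN.
have nb : ~ body S (q + t *: v).
  move=> Sb.
  have : \forall s \near (0 : R), body S (q + t *: v + s *: (- v)).
    have c : q + t *: v + s *: (- v) @[s --> (0 : R)] --> q + t *: v.
      have {2}-> : q + t *: v = q + t *: v + (0 : R) *: (- v) by rewrite scale0r addr0.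
      by apply: cvgD; [exact: cvg_cst|apply: cvgZ; [exact: cvg_id|exact: cvg_cst]].
    by apply: c; apply: open_nbhs_nbhs; split=> //; exact: body_open.
  move=> [e /= e0 he]; pose s := Num.min e t / 2.
  have s0 : 0 < s by rewrite divr_gt0// lt_min e0.
  have ss : s < Num.min e t by rewrite ltr_pdivrMr// ltr_pMr ?ltr1n// lt_min e0.
  move: ss; rewrite lt_min => /andP[se st].
  by apply: (back s) => //; apply: he; rewrite /= sub0r normrN gtr0_norm.
have [r rS rE] := boundary_bdry HS clS nb.
exists r; split=> //; rewrite leNgt; apply/negP => cneg.
have [|s0 s00 h] := bdry_inward HS rS (w := - v); first by rewrite crossNr oppr_gt0.
pose s := Num.min s0 (t / 2).
have sp : 0 < s by rewrite lt_min s00 divr_gt0.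
apply: (back s) => //.
  by rewrite gt_min ltr_pdivrMr// ltr_pMr ?ltr1n// orbT.
by rewrite -rE; apply: h => //; rewrite ge_min lexx.
Qed.

(** The definition of a gas separates only the open bodies. At a common boundary point the two unit
    tangents must be opposite, since otherwise some direction enters both bodies. Then the outward
    normal of one scatterer enters the other, which gives free paths shorter than [tm]. *)
Lemma closures_disjoint i j S S' q : G i = Some S -> G j = Some S' ->
  closure (body S) q -> closure (body S') q -> i = j.
Proof.
move=> GS GS' cS cS'; apply: contrapT => ij.
have HS := scat GS; have HS' := scat GS'.
have dis := gas_disjoint HG GS GS' ij.
have [tm tm0 free] := hit_bounded_below.
have open_disj (A B : set (R * R)) : open A -> A `&` B = set0 -> A q -> closure B q ->
  False.
  move=> oA AB0 Aq /(_ A (open_nbhs_nbhs (conj oA Aq)))[p [Bp Ap]].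
  by have : (A `&` B) p by []; rewrite AB0.
have nS : ~ body S q by move=> h; exact: (open_disj _ _ (body_open HS) dis h cS').
have nS' : ~ body S' q.
  by move=> h; apply: (open_disj _ _ (body_open HS') _ h cS); rewrite setIC.
have [r rS rq] := boundary_bdry HS cS nS.
have [r' rS' rq'] := boundary_bdry HS' cS' nS'.
set u := tangent S r; set u' := tangent S' r'.
have u1 : dot u u = 1 by exact: tangent_unit.
have u1' : dot u' u' = 1 by exact: tangent_unit.
have uu' : dot u u' = -1.
  have d1 : -1 <= dot u u'.
    by have := dot_unit_norm_le1 u1 u1'; rewrite ler_norml => /andP[].
  apply/eqP; rewrite eq_le d1 andbT leNgt; apply/negP => dgt.
  (* Strictly inward for both scatterers, because the tangents are not opposite. *)
  pose w := perp (u + u').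
  have uw : 0 < cross u w.
    by rewrite /w cross_perpD u1 -ltrBlDl sub0r.
  have uw' : 0 < cross u' w.
    by rewrite /w cross_perpD u1' dotC -ltrBlDr sub0r.
  have [s1 s10 h1] := bdry_inward HS rS uw.
  have [s2 s20 h2] := bdry_inward HS' rS' uw'.
  have sp : 0 < Num.min s1 s2 by rewrite lt_min s10.
  have : (body S `&` body S') (q + Num.min s1 s2 *: w).
    by split; [rewrite -rq; apply: h1|rewrite -rq'; apply: h2];
      rewrite // ge_min lexx ?orbT.
  by rewrite dis.
have u'E : u' = - u by exact: unit_opp.
(* The outward normal of [S], which is the inward normal of [S']. *)
pose v := - perp u.
have v1 : dot v v = 1 by rewrite dot_Nperp.
have uv : cross u v = -1 by rewrite cross_Nperp u1.
have [cz vz] := velocity_surj HS rS v1 (ltac:(by rewrite -/u uv lerN10)).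
have [|s2 s20 h2] := bdry_inward HS' rS' (w := v).
  by rewrite -/u' u'E crossNl uv opprK.
pose s := Num.min s2 (tm / 2).
have sp : 0 < s by rewrite lt_min s20 divr_gt0.
apply: (free _ _ _ s GS cz) => //.
  by rewrite gt_min ltr_pdivrMr// ltr_pMr ?ltr1n// orbT.
exists j, S'; split=> //; apply: subset_closure.
by rewrite vz /position /= rq -rq'; apply: h2 => //; rewrite ge_min lexx.
Qed.

Lemma position_closure i S z : G i = Some S -> coordinates S z ->
  closure (body S) (position S z).
Proof.
by move=> GS /coordinatesP[z1 _]; apply: (bdry_boundary (scat GS) _).1.
Qed.

Lemma collision_exists i S z : G i = Some S -> coordinates S z ->
  exists y, collision G (i, z) y.
Proof.
move=> GS cz; have [t ft] := next_hit GS cz.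
have [t0 [j [S' [GS' cl]]] _] := ft.
have [r [rS' rE cr]] := hit_boundary ft GS' cl.
have HS' := scat GS'.
pose v' := reflect_along (tangent S' r) (velocity S z).
have v1 : dot v' v' = 1.
  by rewrite dot_reflect_along ?velocity_unit//; [exact: scat GS|exact: tangent_unit].
have [|cy vy] := velocity_surj HS' rS' v1.
  by rewrite cross_reflect_along oppr_le0.
exists (j, (r, acos (- dot (tangent S' r) v'))), S, S', t; split=> //.
Qed.

(** Disjoint closures fix the scatterer hit, injectivity of [bdry] the arc-length coordinate, and
    the outgoing velocity the angle. *)
Lemma collision_unique x y y' : collision G x y -> collision G x y' -> y = y'.
Proof.
move=> [S [S1 [t [[GS cx] [GS1 cy] ft py vy]]]].
move=> [S' [S2 [t' [[GS' cx'] [GS2 cy'] ft' py' vy']]]].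
move: GS'; rewrite GS => -[?]; subst S'.
have ? := first_hit_inj ft ft'; subst t'.
have ij : y.1 = y'.1.
  apply: (closures_disjoint GS1 GS2 (q := position S1 y.2)).
    exact: position_closure GS1 cy.
  by rewrite py -py'; exact: position_closure GS2 cy'.
move: GS2; rewrite -ij GS1 => -[?]; subst S2.
have HS1 := scat GS1.
have r12 : y.2.1 = y'.2.1.
  apply: (bdry_inj HS1); rewrite ?inE;
    [by case/coordinatesP: cy|by case/coordinatesP: cy'|].
  by rewrite -/(position _ _) py -py'.
rewrite (surjective_pairing y) (surjective_pairing y') ij; congr pair.
have v12 : velocity S1 y.2 = velocity S1 y'.2.
  rewrite vy vy' r12; reflexivity.
exact (velocity_inj HS1 cy cy' r12 v12).
Qed.

Definition reverse_phase x : phase R I := (x.1, reverse x.2).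

(** The same free segment is run backwards in the same time, and reflection is an involution. *)
Lemma collision_rev x y : collision G x y -> collision G (reverse_phase y) (reverse_phase
  x).
Proof.
move=> [S [S' [t [[GS cx] [GS' cy] [t0 Ot free] py vy]]]].
have HS := scat GS; have HS' := scat GS'.
have vr : velocity S' (reverse y.2) = - velocity S x.2.
  by rewrite velocity_reverse// vy reflect_alongK//; exact: tangent_unit.
have prx : position S x.2 = position S' y.2 + t *: (- velocity S x.2).
  by rewrite py -addrA -scalerDr subrr scaler0 addr0.
have pry : position S' (reverse_phase y).2 = position S' y.2 by [].
have prx' : position S (reverse_phase x).2 = position S x.2 by [].
have vr' : velocity S' (reverse_phase y).2 = - velocity S x.2 by exact: vr.
exists S', S, t; split.
- exact (conj GS' (coordinates_reverse cy)).
- exact (conj GS (coordinates_reverse cx)).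
- rewrite pry vr'; split; first exact: t0.
    exists x.1, S; split; first exact: GS.
    rewrite -prx; exact: position_closure GS cx.
  move=> s s0 st; rewrite py line_reverse.
  by apply: free; rewrite ?subr_gt0// gtrBl.
- by rewrite pry prx' vr' -prx.
- by rewrite vr' reflect_alongN; exact: velocity_reverse.
Qed.

Lemma billiard_mapP x y : phase_space G x -> billiard_map G x = y <-> collision G x y.
Proof.
move=> [S GS cx]; have [y0 cy0] : exists y, collision G x y.
  by rewrite (surjective_pairing x); exact: collision_exists GS cx.
rewrite /billiard_map; split=> [<-|cy].
  exact: xgetI cy0.
by apply: (collision_unique _ cy); exact: xgetI cy0.
Qed.

Lemma billiard_map_out x : ~ phase_space G x -> billiard_map G x = x.
Proof.
move=> nx; rewrite /billiard_map; case: xgetP => // y _ [S [_ [_ [[GS cx] _ _ _ _]]]].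
by case: nx; exists S.
Qed.

Lemma billiard_map_phase x : phase_space G (billiard_map G x) <-> phase_space G x.
Proof.
have [px|nx] := pselect (phase_space G x); last by rewrite billiard_map_out.
split=> // _; have /(billiard_mapP _ px).1[S [S' [t [_ [GS' cy] _ _ _]]]] := erefl
  (billiard_map G x).
by exists S'.
Qed.

End collisions.

(** * Invariance properties of the Lebesgue measure *)

Section lebesgue_invariance.
Context {R : realType}.
Notation mu := (@lebesgue_measure R).
Local Open Scope ereal_scope.
Implicit Types (f : R -> \bar R) (c : R).

Lemma measurable_shift c : measurable_fun setT ((fun x => x + c)%R : measurableTypeR R ->
  measurableTypeR R).
Proof. by apply: measurable_funD => //; exact: measurable_cst. Qed.

Lemma lebesgue_measure_shift c (A : set R) : measurable A ->
  mu ((fun x => x + c)%R @^-1` A) = mu A.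
Proof.
move=> mA; pose m : {measure set (measurableTypeR R) -> \bar R} :=
  measure_function_pushforward__canonical__measure_function_Measure mu (measurable_shift c).
rewrite -[LHS]/(m A); apply/esym; apply: lebesgue_measure_unique => //= _ [[a b]] _ <-.
rewrite /m /= /pushforward.
rewrite (_ : _ @^-1` _ = `](a - c)%R, (b - c)%R]%classic); last first.
  by apply/seteqP; split=> x /=; rewrite !in_itv/= ltrBlDr lerBrDr.
rewrite !lebesgue_measure_itv/= !lte_fin ltrD2r; case: ifP => // _.
by rewrite -!EFinD; congr EFin; ring.
Qed.

Lemma ge0_integral_shift c f (D : set R) : measurable D ->
  measurable_fun setT f -> (forall x, 0 <= f x) ->
  \int[mu]_(x in [set x | D (x + c)%R]) f (x + c)%R = \int[mu]_(x in D) f x.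
Proof.
move=> mD mf f0.
rewrite -[LHS](@ge0_integral_pushforward _ _ (measurableTypeR R) (measurableTypeR R) R _
  (measurable_shift c) mu D f)//; last first.
  exact: measurable_funTS.
apply: eq_measure_integral; first exact: measurable_shift.
by move=> ? A mA _; exact: lebesgue_measure_shift.
Qed.

Lemma ge0_integralN f : measurable_fun setT f -> (forall x, 0 <= f x) ->
  \int[mu]_x f (- x)%R = \int[mu]_x f x.
Proof.
move=> mf f0.
have mN : measurable_fun setT (-%R : measurableTypeR R -> measurableTypeR R) by [].
rewrite -[LHS](@ge0_integral_pushforward _ _ (measurableTypeR R) (measurableTypeR R) R _ mN
  mu setT f)//.
by apply: eq_measure_integral => //= A mA _; exact: lebesgue_measureN.
Qed.

Lemma ge0_integral_reflect c f : measurable_fun setT f -> (forall x, 0 <= f x) ->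
  \int[mu]_x f (c - x)%R = \int[mu]_x f x.
Proof.
move=> mf f0.
rewrite -[RHS]ge0_integralN// -(@ge0_integral_shift (- c) (fun x => f (- x)%R) setT)//.
- by apply: eq_integral => x _; rewrite opprD opprK addrC.
- by apply: measurableT_comp => //.
Qed.

(** The shifted interval is cut at [P], and the part beyond [P] is moved back by one period. *)
Lemma ge0_integral_periodic (P c : R) f : measurable_fun setT f ->
  (forall x, 0 <= f x) -> (forall x, f (x + P)%R = f x) ->
  (0 <= c)%R -> (c <= P)%R ->
  \int[mu]_(x in `[0%R, P[) f (x + c)%R = \int[mu]_(x in `[0%R, P[) f x.
Proof.
move=> mf f0 fP c0 cP.
have sE : `[0%R, P[%classic = [set x : R | `[c, (P + c)%R[%classic (x + c)%R].
  by apply/seteqP; split=> x /=; rewrite !in_itv/= lerDr ltrD2r.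
rewrite [in LHS]sE ge0_integral_shift//.
have E1 : `[c, (P + c)%R[%classic = `[c, P[%classic `|` `[P, (P + c)%R[%classic :> set R.
  apply/seteqP; split=> x /=; rewrite !in_itv/=.
    by move=> /andP[cx xP]; have [xP'|Px] := ltP x P; [left; rewrite cx|right].
  move=> [/andP[-> xP]|/andP[Px ->]]; first by rewrite (lt_le_trans xP)// lerDl.
  by rewrite (le_trans cP).
have E2 : `[0%R, P[%classic = `[0%R, c[%classic `|` `[c, P[%classic :> set R.
  apply/seteqP; split=> x /=; rewrite !in_itv/=.
    by move=> /andP[x0 xP]; have [xc|cx] := ltP x c; [left; rewrite x0|right].
  move=> [/andP[-> xc]|/andP[cx ->]]; first by rewrite (lt_le_trans xc).
  by rewrite (le_trans c0).
have disj (x y z : R) : [disjoint `[x, y[%classic & `[y, z[%classic].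
  apply/disj_setPS => t [] /=; rewrite !in_itv/= => /andP[_ ty] /andP[yt _].
  by have := lt_le_trans ty yt; rewrite ltxx.
rewrite E1 E2 !ge0_integral_setU//; last 2 first.
- exact: measurable_funTS.
- exact: measurable_funTS.
rewrite addeC; congr (_ + _).
rewrite -(@ge0_integral_shift P f `[P, (P + c)%R[%classic)//.
rewrite (_ : [set x : R | `[P, (P + c)%R[%classic (x + P)%R] = `[0%R, c[%classic).
  by apply: eq_integral => x _; rewrite fP.
by apply/seteqP; split=> x /=; rewrite !in_itv/= lerDr [(P + c)%R]addrC ltrD2r.
Qed.

End lebesgue_invariance.

(** * The measure on lines *)

Section line_measure.
Context {R : realType}.
Notation mu := (@lebesgue_measure R).

Definition direction (t : R) : R * R := (cos t, sin t).

Lemma direction_unit t : dot (direction t) (direction t) = 1.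
Proof. by rewrite /dot /direction /= -!expr2 cos2Dsin2. Qed.

Lemma directionDpi t : direction (t + pi) = - direction t.
Proof. by rewrite /direction cosDpi sinDpi. Qed.

Lemma direction_periodic t : direction (t + pi *+ 2) = direction t.
Proof. by rewrite mulr2n addrA !directionDpi opprK. Qed.

Lemma unit_direction (v : R * R) : dot v v = 1 ->
  exists c, [/\ 0 <= c, c <= pi *+ 2 & v = direction c].
Proof.
move=> v1; have v12 : v.1 ^+ 2 + v.2 ^+ 2 = 1 by rewrite -v1 /dot !expr2.
have d1 : -1 <= v.1 <= 1.
  rewrite -ler_norml -(@ler_pXn2r _ 2)// ?nnegrE// expr1n real_normK ?num_real//.
  by rewrite -v12 lerDl sqr_ge0.
have sE : Num.sqrt (1 - v.1 ^+ 2) = `|v.2|.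
  by rewrite (_ : 1 - v.1 ^+ 2 = v.2 ^+ 2) ?sqrtr_sqr// -v12; ring.
have a0 := acos_ge0 d1; have api := acos_lepi d1; have p0 := pi_gt0 R.
have [v20|v20] := leP 0 v.2.
  exists (acos v.1); split=> //; first by rewrite (le_trans api)// mulr2n lerDl ltW.
  by rewrite /direction acosK// sin_acos// sE ger0_norm// -surjective_pairing.
exists (pi *+ 2 - acos v.1); split.
- by rewrite subr_ge0 (le_trans api)// mulr2n lerDl ltW.
- by rewrite gerBl.
- rewrite addrC direction_periodic /direction cosN sinN acosK// sin_acos// sE ltr0_norm//
  opprK.
  by rewrite -surjective_pairing.
Qed.

Variable S : scatterer R.
Hypothesis HS : is_scatterer S.
Local Notation u := (tangent S).
Local Notation b := (bdry S).

(** The points of [B] with outgoing velocity [e], given by their coordinate [r] alone since [e]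
    fixes the angle. The strict inequality means that [e] is transversal and outward. *)
Definition outgoing (B : set (R * R)) (e : R * R) : set R :=
  [set r | [/\ r \in `[0, perim S[%R, 0 < cross e (u r) & B (r, acos (- dot (u r) e))]].

(** A line of direction [e] is labelled by its offset [cross e q], which is the same for all its
    points [q]. *)
Definition outgoing_lines (B : set (R * R)) (e : R * R) : set R :=
  (fun r => cross e (b r)) @` outgoing B e.

Lemma outgoing_linesP B e p : dot e e = 1 -> outgoing_lines B e p <->
  exists z, [/\ coordinates S z, B z, 0 < sin z.2, velocity S z = e & cross e (position S
    z) = p].
Proof.
move=> e1; split.
  move=> [r [rS c Br] rp]; have [|cz vz] := velocity_surj HS rS e1.
    by rewrite crossC oppr_le0 ltW.
  exists (r, acos (- dot (u r) e)); split=> //.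
  by rewrite -oppr_lt0 -(cross_velocity HS) vz crossC oppr_lt0.
move=> [z [cz Bz sz vz pz]]; exists z.1 => //; split.
- by case/coordinatesP : cz.
- by rewrite crossC -vz (cross_velocity HS) opprK.
- by rewrite -vz (acos_velocity HS)// -surjective_pairing.
Qed.

(** A line leaves a convex body at one point. For two exit points, each lies to the left of the
    tangent at the other, which forces their signed distance along [e] to be both nonpositive and
    nonnegative. *)
Lemma outgoing_inj e : {in [set r | r \in `[0, perim S[%R /\ 0 < cross e (u r)] &,
  injective (fun r => cross e (b r))}.
Proof.
suff key r1 r2 : r1 \in `[0, perim S[%R -> r2 \in `[0, perim S[%R ->
    0 < cross e (u r1) -> 0 < cross e (u r2) ->
    cross e (b r1) = cross e (b r2) -> b r1 = b r2.
  move=> r1 r2 /set_mem[r1S c1] /set_mem[r2S c2] h.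
  exact (bdry_inj HS r1S r2S (key _ _ r1S r2S c1 c2 h)).
move=> r1S r2S c1 c2 h.
have hB : cross e (b r2 - b r1) = 0 by rewrite crossBr h subrr.
have n1 : cross (u r1) e != 0 by rewrite crossC oppr_eq0 (gt_eqF c1).
have n2 : cross (u r2) e != 0 by rewrite crossC oppr_eq0 (gt_eqF c2).
have E1 := cross_colinear n1 hB.
have l1 := closure_left HS r1 (bdry_boundary HS r2S).1.
have l2 := closure_left HS r2 (bdry_boundary HS r1S).1.
set s := _ / _ in E1.
have s0 : s <= 0.
  by move: l1; rewrite E1 crossZr crossC mulrN oppr_ge0 (pmulr_lle0 _ c1).
have s0' : 0 <= s.
  move: l2; rewrite -opprB E1 crossNr crossZr crossC mulrN opprK.
  by rewrite (pmulr_lge0 _ c2).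
have s00 : s = 0 by apply/le_anti; rewrite s0 s0'.
apply/esym/subr0_eq; rewrite E1 s00; exact: scale0r.
Qed.

(** The derivative of the offset along the boundary is [cross e (u r)], the sine of the outgoing
    angle: this is where the weight sin phi of the billiard measure comes from. *)
Lemma outgoing_lines_measure B e : measurable (outgoing B e) ->
  measurable (outgoing_lines B e) /\
  (mu (outgoing_lines B e) = \int[mu]_(r in outgoing B e) (cross e (u r))%:E)%E.
Proof.
move=> mB; apply: image_integral => //.
- by move=> r; exact: bdry_is_derive_cross.
- exact/cross_continuous/tangent_continuous.
- by move=> r [].
- move=> r1 r2 /set_mem[r1S c1 _] /set_mem[r2S c2 _].
  by apply: (@outgoing_inj e); exact: mem_set.
Qed.

Definition outgoing_graph (B : set (R * R)) : set (R * R) :=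
  [set z | outgoing B (direction z.2) z.1].

Lemma measurable_coordinates : measurable (coordinates S).
Proof. by apply: measurableX. Qed.

(** The open interval suffices: a transversal direction has [dot] with the tangent strictly between
    -1 and 1. *)
Lemma measurable_acos : measurable_fun setT (acos \_ `]-1, 1[%classic : R -> R).
Proof.
apply/(measurable_restrictT _ _).1 => //.
apply: open_continuous_measurable_fun => //.
by move=> x; rewrite inE/= in_itv/= => xI; exact: continuous_acos.
Qed.

Lemma measurable_cross_direction : measurable_fun setT
  (fun z : R * R => cross (direction z.2) (u z.1)).
Proof.
rewrite /cross /direction /=.
apply: measurable_funB; apply: measurable_funM.
- by apply: measurableT_comp; [exact: continuous_measurable_fun (@continuous_cos R)|exact:
  measurable_snd].
- apply: (@measurableT_comp _ _ _ _ _ _ (fun r : R => (u r).2)); last exact: measurable_fst.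
  apply: continuous_measurable_fun => r.
  exact: (cvg_comp _ _ (@tangent_continuous _ _ HS r) (@snd_continuous _ _)).
- by apply: measurableT_comp; [exact: continuous_measurable_fun (@continuous_sin R)|exact:
  measurable_snd].
- apply: (@measurableT_comp _ _ _ _ _ _ (fun r : R => (u r).1)); last exact: measurable_fst.
  apply: continuous_measurable_fun => r.
  exact: (cvg_comp _ _ (@tangent_continuous _ _ HS r) (@fst_continuous _ _)).
Qed.

Lemma measurable_dot_direction : measurable_fun setT
  (fun z : R * R => - dot (u z.1) (direction z.2)).
Proof.
apply: measurableT_comp => //.
rewrite /dot /direction /=.
apply: measurable_funD; apply: measurable_funM.
- apply: (@measurableT_comp _ _ _ _ _ _ (fun r : R => (u r).1)); last exact: measurable_fst.
  apply: continuous_measurable_fun => r.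
  exact: (cvg_comp _ _ (@tangent_continuous _ _ HS r) (@fst_continuous _ _)).
- by apply: measurableT_comp; [exact: continuous_measurable_fun (@continuous_cos R)|exact:
  measurable_snd].
- apply: (@measurableT_comp _ _ _ _ _ _ (fun r : R => (u r).2)); last exact: measurable_fst.
  apply: continuous_measurable_fun => r.
  exact: (cvg_comp _ _ (@tangent_continuous _ _ HS r) (@snd_continuous _ _)).
- by apply: measurableT_comp; [exact: continuous_measurable_fun (@continuous_sin R)|exact:
  measurable_snd].
Qed.

Lemma measurable_outgoing_graph B : measurable B -> measurable (outgoing_graph B).
Proof.
move=> mB.
pose k (z : R * R) : R * R := (z.1, (acos \_ `]-1, 1[%classic) (- dot (u z.1) (direction
  z.2))).
have mk : measurable_fun setT k.
  apply: measurable_fun_pair; first exact: measurable_fst.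
  by apply: measurableT_comp; [exact: measurable_acos|exact: measurable_dot_direction].
have -> : outgoing_graph B = (`[0, perim S[%classic `*` setT) `&`
    ((fun z : R * R => cross (direction z.2) (u z.1)) @^-1` `]0, +oo[%classic) `&` (k @^-1`
      B).
  have acosE (z : R * R) : 0 < cross (direction z.2) (u z.1) ->
      k z = (z.1, acos (- dot (u z.1) (direction z.2))).
    move=> c; rewrite /k patchE ifT// inE/= in_itv/= -ltr_norml normrN.
    rewrite -(@ltr_pXn2r _ 2)// ?nnegrE// expr1n real_normK ?num_real//.
    have := dot_cross_sqr (u z.1) (direction z.2).
    rewrite tangent_unit// direction_unit mulr1 => <-.
    by rewrite ltrDl crossC sqrrN exprn_gt0.
  apply/seteqP; split=> z /=.
    by move=> [zS c Bz]; rewrite acosE//; split=> //; split; rewrite ?in_itv/= ?andbT.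
  by move=> [[[zS _] + Bz]]; rewrite in_itv/= andbT => c; rewrite acosE// in Bz.
apply: measurableI; first apply: measurableI.
- by apply: measurableX.
- by rewrite -[_ @^-1` _]setTI; exact: measurable_cross_direction.
- by rewrite -[_ @^-1` _]setTI; exact: mk.
Qed.

Lemma measurable_outgoing B t : measurable B -> measurable (outgoing B (direction t)).
Proof.
move=> /measurable_outgoing_graph h.
have -> : outgoing B (direction t) = ysection (outgoing_graph B) t.
  by rewrite ysectionE.
exact: measurable_ysection.
Qed.

Definition scatterer_measure (B : set (R * R)) : \bar R :=
  (\int[mu \x mu]_(z in coordinates S `&` B) (sin z.2)%:E)%E.

Lemma measurable_line_density B : measurable B -> measurable_fun setT
  ((fun z => (cross (direction z.2) (u z.1))%:E) \_ (outgoing_graph B) : R * R -> \bar R).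
Proof.
move=> mB; apply/(measurable_restrictT _ _).1; first exact: measurable_outgoing_graph.
by apply/measurable_EFinP; apply: measurable_funTS; exact: measurable_cross_direction.
Qed.

Lemma line_density_ge0 B (z : R * R) :
  (0 <= ((fun z => (cross (direction z.2) (u z.1))%:E) \_ (outgoing_graph B)) z)%E.
Proof. by apply: erestrict_ge0 => {}z [_ c _]; rewrite lee_fin ltW. Qed.

Lemma measurable_sin_density B : measurable B -> measurable_fun setT
  ((fun z => (sin z.2)%:E) \_ (coordinates S `&` B) : R * R -> \bar R).
Proof.
move=> mB; apply/(measurable_restrictT _ _).1.
  by apply: measurableI => //; exact: measurable_coordinates.
apply/measurable_EFinP; apply: measurable_funTS; apply: measurableT_comp;
  last exact: measurable_snd.
exact: continuous_measurable_fun (@continuous_sin R).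
Qed.

Lemma sin_density_ge0 B (z : R * R) :
  (0 <= ((fun z => (sin z.2)%:E) \_ (coordinates S `&` B)) z)%E.
Proof.
apply: erestrict_ge0 => {}z [/coordinatesP[_ c] _]; rewrite lee_fin.
exact: sin_ge0_pi.
Qed.

(* The direction of the velocity at (r, phi) is phi plus an angle that depends
   only on r. *)
Lemma integral_direction B r : measurable B ->
  (\int[mu]_phi ((fun z => (sin z.2)%:E) \_ (coordinates S `&` B)) (r, phi) =
   \int[mu]_(t in `[0%R, (pi *+ 2)%R[)
     ((fun z => (cross (direction z.2) (u z.1))%:E) \_ (outgoing_graph B)) (r, t))%E.
Proof.
move=> mB; have p0 := pi_gt0 R.
set g := (X in (\int[mu]_phi X (r, phi))%E);
  set h := (X in _ = (\int[mu]_(t in _) X (r, t))%E).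
(* The direction of the velocity at angle 0, which is minus the tangent. *)
have [c [c0 cpi uc]] : exists c, [/\ 0 <= c, c <= pi *+ 2 & - u r = direction c].
  apply: unit_direction; have := tangent_unit HS r; rewrite /dot /=.
  by rewrite !mulrNN.
have vE phi : velocity S (r, phi) = direction (phi + c).
  have u1 : (u r).1 = - cos c by rewrite -[LHS]opprK -[- (u r).1]/((- u r).1) uc.
  have u2 : (u r).2 = - sin c by rewrite -[LHS]opprK -[- (u r).2]/((- u r).2) uc.
  rewrite /velocity /perp /direction cosD sinD [LHS]surjective_pairing /= /GRing.scale /=
    u1 u2.
  by congr pair; ring.
rewrite -(@ge0_integral_periodic _ (pi *+ 2) c (fun t => h (r, t)))//; first last.
- move=> t; rewrite /h !patchE /= direction_periodic.
  by congr (if _ then _ else _); apply/idP/idP => /set_mem W; apply/mem_set; move: W;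
    rewrite /outgoing_graph /= direction_periodic.
- by move=> t; exact: line_density_ge0.
- have := measurable_line_density mB; exact: measurable_fun_pair2.
rewrite [RHS]integral_mkcond; apply: eq_integral => phi _.
have cE : cross (direction (phi + c)) (u r) = sin phi.
  by rewrite -vE crossC (cross_velocity HS (r, phi)) opprK.
have dE : - dot (u r) (direction (phi + c)) = cos phi.
  by rewrite -vE (dot_velocity HS (r, phi)) opprK.
rewrite patchE; case: ifPn => [|phiI]; last first.
  rewrite /g patchE ifF//; apply/negbTE/negP => /set_mem [/coordinatesP[_ /= /andP[x1 x2]]
    _].
  move/negP : phiI; apply; apply/mem_set; rewrite /= in_itv/= x1/= (le_lt_trans x2)//.
  by rewrite mulr2n ltrDl.
move=> /set_mem; rewrite /= in_itv/= => /andP[phi0 phi2].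
(* Up to pi the integrands agree; beyond pi the sine is negative and both vanish. *)
have [phipi|piphi] := leP phi pi.
  have acE : acos (cos phi) = phi by rewrite cosK// in_itv/= phi0.
  have s0 : 0 <= sin phi by apply: sin_ge0_pi; rewrite phi0.
  rewrite /g /h !patchE; case: ifPn => [/set_mem[/coordinatesP[/= rS _] Br]|nB].
    case: ifPn => [_|]; first by rewrite cE.
    (* A grazing angle: the point is in [coordinates] but not in the graph, and its sine is 0. *)
    move/negP => nW; congr EFin; apply/le_anti; rewrite s0 andbT leNgt; apply/negP => sp.
    by apply: nW; apply/mem_set; split=> //=; rewrite ?cE// dE acE.
  case: ifPn => [/set_mem[/= rS c1]|//]; rewrite dE acE => Br.
  by case/negP: nB; apply/mem_set; split=> //; apply/coordinatesP; split=> //=;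
    rewrite phi0.
have s0 : sin phi < 0.
  rewrite -[phi](subrK pi) sinDpi oppr_lt0 sin_gt0_pi// subr_gt0 piphi/=.
  by rewrite ltrBlDr -mulr2n.
rewrite /g /h !patchE ifF; last first.
  by apply/negbTE/negP => /set_mem[/coordinatesP[_ /= /andP[_]]]; rewrite leNgt piphi.
rewrite ifF//; apply/negbTE/negP => /set_mem[/= _]; rewrite cE => /lt_trans/(_ s0).
by rewrite ltxx.
Qed.

(** At fixed [r] the angle is exchanged for the direction, which is a rotation; after swapping the
    integrals, the integral over [r] at fixed direction is the length of a set of offsets. *)
Lemma scatterer_measure_lines B : measurable B ->
  (scatterer_measure B =
   \int[mu]_(t in `[0%R, (pi *+ 2)%R[) mu (outgoing_lines B (direction t)))%E.
Proof.
move=> mB; rewrite /scatterer_measure integral_mkcond fubini_tonelli1//; first last.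
- by move=> z; exact: sin_density_ge0.
- exact: measurable_sin_density.
set h := (fun z => (cross (direction z.2) (u z.1))%:E) \_ (outgoing_graph B).
pose J : set (R * R) := setT `*` `[0%R, (pi *+ 2)%R[%classic.
have mJ : measurable J by apply: measurableX.
transitivity (\int[mu]_r \int[mu]_t (h \_ J) (r, t))%E.
  apply: eq_integral => r _; rewrite /fubini_F integral_direction// integral_mkcond.
  apply: eq_integral => t _; rewrite !patchE; congr (if _ then _ else _).
  by apply/idP/idP => /set_mem; [move=> ?; apply/mem_set; split|move=> [_ ?];
    exact/mem_set].
rewrite (@fubini_tonelli _ _ _ _ _ mu mu (h \_ J)); last 2 first.
- apply/(measurable_restrictT _ _).1 => //; apply: measurable_funTS.
  exact: measurable_line_density.
- by move=> z; apply: erestrict_ge0 => {}z _; exact: line_density_ge0.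
rewrite [RHS]integral_mkcond; apply: eq_integral => t _.
rewrite [RHS]patchE; case: ifPn => tI; last first.
  rewrite integral0_eq// => r _; rewrite patchE ifF//.
  by apply: contraNF tI => /set_mem[_ ?]; exact/mem_set.
have [_ ->] := outgoing_lines_measure (measurable_outgoing t mB).
rewrite [RHS]integral_mkcond; apply: eq_integral => r _.
rewrite patchE ifT; last by apply/mem_set; split=> //; exact/set_mem.
rewrite /h !patchE; congr (if _ then _ else _).
Qed.

Lemma mu_outgoing_linesE B t : measurable B ->
  (mu (outgoing_lines B (direction t)) =
  \int[mu]_r ((fun z => (cross (direction z.2) (u z.1))%:E) \_ (outgoing_graph B)) (r,
    t))%E.
Proof.
move=> mB; have [_ ->] := outgoing_lines_measure (measurable_outgoing t mB).
rewrite integral_mkcond; apply: eq_integral => r _.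
by rewrite !patchE; congr (if _ then _ else _).
Qed.

Lemma measurable_mu_outgoing_lines B : measurable B ->
  measurable_fun setT (fun t => mu (outgoing_lines B (direction t))).
Proof.
move=> mB; under eq_fun do rewrite mu_outgoing_linesE//.
apply: (@measurable_fun_fubini_tonelli_G _ _ _ _ _ mu
  ((fun z => (cross (direction z.2) (u z.1))%:E) \_ (outgoing_graph B))).
  exact: measurable_line_density.
by move=> z; exact: line_density_ge0.
Qed.

(** * Time reversal and incoming lines *)

Lemma measurable_reverse : measurable_fun setT (@reverse R).
Proof.
apply: measurable_fun_pair; first exact: measurable_fst.
by apply: measurable_funB; [exact: measurable_cst|exact: measurable_snd].
Qed.

Lemma measurable_preimage_reverse B : measurable B -> measurable (@reverse R @^-1` B).
Proof. by move=> mB; rewrite -[_ @^-1` _]setTI; exact: measurable_reverse. Qed.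

Lemma scatterer_measure_reverse B : measurable B ->
  scatterer_measure (@reverse R @^-1` B) = scatterer_measure B.
Proof.
move=> mB; have mrB := measurable_preimage_reverse mB.
rewrite /scatterer_measure integral_mkcond [RHS]integral_mkcond !fubini_tonelli1//;
  try (by move=> z; exact: sin_density_ge0); try exact: measurable_sin_density.
apply: eq_integral => r _; rewrite /fubini_F.
set g := (fun z => (sin z.2)%:E) \_ (coordinates S `&` B).
rewrite -(@ge0_integral_reflect _ pi (fun phi => g (r, phi))).
- apply: eq_integral => phi _; rewrite /g !patchE /= sinB sinpi cospi mul0r mulN1r opprK
  add0r.
  congr (if _ then _ else _).
  apply/idP/idP => /set_mem[c Bz]; apply/mem_set; split=> //.
    exact (coordinates_reverse c).
  by rewrite -(reverseK (r, phi)); exact: coordinates_reverse.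
- by have := measurable_sin_density mB; exact: measurable_fun_pair2.
- by move=> phi; exact: sin_density_ge0.
Qed.

(** Reflecting the outgoing velocity gives back the velocity before the collision, so [e] is the
    direction of arrival. *)
Definition incoming_lines (B : set (R * R)) (e : R * R) : set R :=
  [set p | exists z, [/\ coordinates S z, B z, 0 < sin z.2,
    reflect_along (u z.1) (velocity S z) = e & cross e (position S z) = p]].

(** Reversal turns arrivals along [e] into departures along [- e], and the offset changes sign with
    the direction. *)
Lemma incoming_linesE B e : dot e e = 1 ->
  incoming_lines B e = -%R @^-1` (outgoing_lines (@reverse R @^-1` B) (- e)).
Proof.
move=> e1; have ne1 : dot (- e) (- e) = 1 by rewrite -e1 /dot /= !mulrNN.
have sE (z : R * R) : sin (reverse z).2 = sin z.2.
  by rewrite /= sinB sinpi cospi mul0r mulN1r opprK add0r.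
apply/seteqP; split=> p /=.
  move=> [z [cz Bz sz vz pz]]; apply/outgoing_linesP => //; exists (reverse z); split.
  - exact: coordinates_reverse.
  - by rewrite /= reverseK.
  - by rewrite sE.
  - by rewrite velocity_reverse// vz.
  - by rewrite crossNl -pz.
move=> /outgoing_linesP[//|z [cz Bz sz vz pz]]; exists (reverse z); split=> //.
- exact: coordinates_reverse.
- by rewrite sE.
- by rewrite -[LHS]opprK -[X in - X](velocity_reverse HS) reverseK vz opprK.
- by rewrite -[LHS]opprK -crossNl -[X in - X]/(cross (- e) (position S z)) pz opprK.
Qed.

Lemma mu_incoming_linesE B t : measurable B ->
  mu (incoming_lines B (direction t)) =
  mu (outgoing_lines (@reverse R @^-1` B) (direction (t + pi))).
Proof.
move=> mB; rewrite incoming_linesE ?direction_unit// -directionDpi.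
apply: lebesgue_measureN.
apply: (outgoing_lines_measure _).1; apply: measurable_outgoing.
exact: measurable_preimage_reverse.
Qed.

Lemma measurable_incoming_lines B t : measurable B ->
  measurable (incoming_lines B (direction t)).
Proof.
move=> mB; rewrite incoming_linesE ?direction_unit// -directionDpi.
have mN : measurable_fun setT (-%R : R -> R) by [].
rewrite -[_ @^-1` _]setTI; apply: mN => //.
apply: (outgoing_lines_measure _).1; apply: measurable_outgoing.
exact: measurable_preimage_reverse.
Qed.

(** Follows from the outgoing formula, since reversal preserves the measure of a scatterer; the
    half-turn of the direction is absorbed by periodicity. *)
Lemma scatterer_measure_incoming B : measurable B ->
  (scatterer_measure B =
   \int[mu]_(t in `[0%R, (pi *+ 2)%R[) mu (incoming_lines B (direction t)))%E.
Proof.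
move=> mB; have mrB := measurable_preimage_reverse mB; have p0 := pi_gt0 R.
under eq_integral do rewrite mu_incoming_linesE//.
rewrite (@ge0_integral_periodic _ (pi *+ 2) pi
  (fun t => mu (outgoing_lines (@reverse R @^-1` B) (direction t)))).
- by rewrite -scatterer_measure_lines// scatterer_measure_reverse.
- exact: measurable_mu_outgoing_lines.
- by [].
- by move=> t; rewrite direction_periodic.
- exact: ltW.
- by rewrite mulr2n lerDl ltW.
Qed.

Lemma incoming_inj e z z' : coordinates S z -> coordinates S z' ->
  0 < sin z.2 -> 0 < sin z'.2 ->
  reflect_along (u z.1) (velocity S z) = e ->
  reflect_along (u z'.1) (velocity S z') = e ->
  cross e (position S z) = cross e (position S z') -> z = z'.
Proof.
move=> cz cz' sz sz' vz vz' pz.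
have out w : 0 < sin w.2 -> reflect_along (u w.1) (velocity S w) = e ->
    0 < cross (- e) (u w.1).
  move=> sw vw; rewrite crossNl crossC opprK -vw cross_reflect_along.
  by rewrite (cross_velocity HS) opprK.
have r1 : z.1 = z'.1.
  have [zS _] := (coordinatesP _ _).1 cz; have [zS' _] := (coordinatesP _ _).1 cz'.
  apply: (@outgoing_inj (- e)).
  - exact: (mem_set (conj zS (out _ sz vz))).
  - exact: (mem_set (conj zS' (out _ sz' vz'))).
  - by rewrite !crossNl; congr (- _).
apply: (velocity_inj HS cz cz' r1).
rewrite -[velocity S z](reflect_alongK _ (tangent_unit HS z.1)) vz.
by rewrite -[velocity S z'](reflect_alongK _ (tangent_unit HS z'.1)) vz' r1.
Qed.

(* On a tangent line parallel to e, cross e is extremal over the scatterer. *)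
Definition tangent_lines (e : R * R) : set R :=
  [set p | exists r, [/\ r \in `[0, perim S[%R, cross e (u r) = 0 & cross e (b r) = p]].

(** The tangent vector is [e] or [- e], and each choice determines the extremal offset, so there are
    at most two lines. *)
Lemma finite_tangent_lines e : dot e e = 1 -> finite_set (tangent_lines e).
Proof.
move=> e1.
pose C (v : R * R) := [set p | exists r, [/\ r \in `[0, perim S[%R, u r = v & cross e (b r)
  = p]].
have uC v : (v = e \/ v = - e) -> is_subset1 (C v).
  move=> ve.
  suff key r1 r2 : r1 \in `[0, perim S[%R -> r2 \in `[0, perim S[%R ->
      u r1 = v -> u r2 = v -> cross v (b r1) <= cross v (b r2).
    move=> p q [r1 [r1S u1 <-]] [r2 [r2S u2 <-]].
    have h1 := key _ _ r1S r2S u1 u2; have h2 := key _ _ r2S r1S u2 u1.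
    have E : cross v (b r1) = cross v (b r2) by apply/le_anti; rewrite h1 h2.
    case: ve => ve; move: E; rewrite ve ?crossNl; first by [].
    by move/oppr_inj.
  move=> r1S r2S u1 u2.
  have := closure_left HS r1 (bdry_boundary HS r2S).1.
  by rewrite u1 crossBr subr_ge0.
have fC v : (v = e \/ v = - e) -> finite_set (C v).
  move=> /uC uCv; have [[p Cp]|nC] := pselect (C v !=set0).
    apply: (@sub_finite_set _ _ [set p]); last exact: finite_set1.
    by move=> q Cq; exact: uCv.
  by rewrite (_ : C v = set0) ?finite_set0//; apply/seteqP; split=> // p Cp; apply: nC;
    exists p.
apply: (@sub_finite_set _ _ (C e `|` C (- e))).
  move=> p [r [rS c rp]].
  have [ue|ue] := unit_eq e1 (tangent_unit HS r) c; [left|right]; by exists r.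
by rewrite finite_setU; split; apply: fC; [left|right].
Qed.

End line_measure.

(** * The billiard measure *)

Section countable_index.
Context {R : realType} {I : choiceType} (f : I -> nat).
Hypothesis f_inj : injective f.
Local Open Scope ereal_scope.

(** A partial inverse of the numbering [f], by which sums and unions over indices become series and
    countable unions. *)
Definition index_of (n : nat) : option I :=
  if pselect (exists i, f i = n) is left e then Some (projT1 (cid e)) else None.

Lemma index_ofK : pcancel f index_of.
Proof.
move=> i; rewrite /index_of; case: pselect => [e|]; last by case; exists i.
by congr Some; apply: f_inj; case: cid.
Qed.

Lemma index_of_inv n i : index_of n = Some i -> f i = n.
Proof. by rewrite /index_of; case: pselect => // e [<-]; case: cid. Qed.

Lemma esum_index (a : I -> \bar R) : (forall i, 0 <= a i) ->
  \esum_(i in [set: I]) a i = \sum_(n <oo) oapp a 0 (index_of n).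
Proof.
move=> a0; pose b n := oapp a 0 (index_of n).
have b0 n : 0 <= b n by rewrite /b; case: index_of.
rewrite nneseries_esumT//.
transitivity (\esum_(n in f @` [set: I]) b n).
  rewrite esum_image//; last by move=> i j _ _; exact: f_inj.
  by apply: eq_esum => i _; rewrite /b index_ofK.
rewrite esum_mkcond; apply: eq_esum => n _; case: ifPn => // /negP nf.
rewrite -/(b n) /b; case E : (index_of n) => [i|]//=; exfalso; apply: nf.
by apply/mem_set; exists i => //; exact: index_of_inv.
Qed.

End countable_index.

Lemma exchange_esum (R : realType) (I J : choiceType) (a : I -> J -> \bar R) :
  (forall i j, (0 <= a i j)%E) ->
  (\esum_(i in [set: I]) \esum_(j in [set: J]) a i j =
   \esum_(j in [set: J]) \esum_(i in [set: I]) a i j)%E.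
Proof.
move=> a0; rewrite !esum_esum//.
rewrite (reindex_esum ([set: J] `*`` (fun=> [set: I])) ([set: I] `*`` (fun=> [set: J]))
  (fun p => (p.2, p.1)))//.
split=> //.
- by move=> [n i] [n' i'] _ _ [-> ->].
- by move=> [i n] _; exists (n, i).
Qed.

Section billiard_measure.
Context {R : realType}.
Local Open Scope ereal_scope.
Notation mu := (@lebesgue_measure R).

Lemma measurable_sin_on (D : set (R * R)) : measurable_fun D (fun z : R * R => (sin
  z.2)%:E).
Proof.
apply/measurable_EFinP; apply: measurable_funTS.
apply: measurableT_comp; last exact: measurable_snd.
exact: continuous_measurable_fun (@continuous_sin R).
Qed.

Lemma sin_coordinates_ge0 (S : scatterer R) z : coordinates S z -> (0 <= sin z.2)%R.
Proof. by move=> /coordinatesP[_ c]; exact: sin_ge0_pi. Qed.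

Lemma scatterer_measure_ge0 (S : scatterer R) B : 0 <= scatterer_measure S B.
Proof. by apply: integral_ge0 => z [/sin_coordinates_ge0]; rewrite lee_fin. Qed.

Lemma scatterer_measure0 (S : scatterer R) : scatterer_measure S set0 = 0.
Proof. by rewrite /scatterer_measure setI0 integral_set0. Qed.

Lemma scatterer_measure_bigcup (S : scatterer R) (F : (set (R * R))^nat) :
  (forall n, measurable (F n)) -> trivIset setT F ->
  scatterer_measure S (\bigcup_n F n) = \sum_(n <oo) scatterer_measure S (F n).
Proof.
move=> mF tF; rewrite /scatterer_measure setI_bigcupr.
rewrite (@ge0_integral_bigcup _ (measurableTypeR R * measurableTypeR R)%type _ (mu \x mu)
  (fun n => coordinates S `&` F n))//.
- by move=> n; apply: measurableI; [exact (measurable_coordinates S)|exact (mF n)].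
- exact: measurable_sin_on.
- by move=> z [n _ [/sin_coordinates_ge0]]; rewrite lee_fin.
- exact: trivIset_setIl.
Qed.

Lemma scatterer_measure_fin (S : scatterer R) B : measurable B ->
  scatterer_measure S B < +oo.
Proof.
move=> mB; have mc := measurable_coordinates S.
apply: (@le_lt_trans _ _ (\int[mu \x mu]_(z in coordinates S) (cst 1) z)).
  apply: (@le_trans _ _ (\int[mu \x mu]_(z in coordinates S `&` B) (cst 1) z)).
    apply: ge0_le_integral => //.
    - exact: measurableI.
    - by move=> z [/sin_coordinates_ge0]; rewrite lee_fin.
    - exact: measurable_sin_on.
    - by move=> z _; rewrite lee_fin sin_le1.
  apply: ge0_subset_integral => //; first exact: measurableI.
rewrite integral_cst// mul1e.
rewrite [X in X < _](_ : _ = mu `[0%R, perim S[%classic * mu `[0%R, pi]%classic);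
  last first.
  by apply: product_measure1E.
by rewrite !lebesgue_measure_itv/=; do 2! case: ifP => _;
  rewrite ?mule0 ?mul0e -?EFinM ?ltry.
Qed.

End billiard_measure.

Section phase_measure.
Context {R : realType} {I : pointedType}.
Local Open Scope ereal_scope.
Implicit Types (G : gas R I) (A : set (phase R I)).

Definition piece G (i : I) (B : set (R * R)) : \bar R :=
  if G i is Some s then scatterer_measure s B else 0.

Lemma piece_ge0 G i B : 0 <= piece G i B.
Proof. by rewrite /piece; case: (G i) => // S; exact: scatterer_measure_ge0. Qed.

Lemma billiard_measureE G A :
  billiard_measure G A = \esum_(i in [set: I]) piece G i [set z | A (i, z)].
Proof. by []. Qed.

Lemma measurable_section A i : measurable A -> measurable [set z | A (i, z)].
Proof.
move=> mA.
have -> : [set z | A (i, z)] = xsection A (i : discrete I) by rewrite xsectionE.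
exact: (@measurable_xsection _ _ (discrete I) (R * R)%type A i mA).
Qed.

Lemma piece_bigcup G i (F : (set (R * R))^nat) :
  (forall n, measurable (F n)) -> trivIset setT F ->
  piece G i (\bigcup_n F n) = \sum_(n <oo) piece G i (F n).
Proof.
rewrite /piece; case: (G i) => [s|] mF tF; first exact: scatterer_measure_bigcup.
by rewrite eseries0.
Qed.

Let billiard_measure0 G : billiard_measure G set0 = 0.
Proof.
rewrite billiard_measureE esum1// => i _; rewrite /piece; case: (G i) => // S.
by rewrite (_ : [set z | _] = set0) ?scatterer_measure0.
Qed.

Let billiard_measure_ge0 G A : 0 <= billiard_measure G A.
Proof. by apply: esum_ge0 => i _; exact: piece_ge0. Qed.

Let billiard_measure_sigma_additive G : semi_sigma_additive (billiard_measure G).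
Proof.
move=> F mF tF mUF.
have -> : billiard_measure G (\bigcup_n F n) = \sum_(n <oo) billiard_measure G (F n).
  rewrite billiard_measureE nneseries_esumT; last by move=> n; exact: billiard_measure_ge0.
  transitivity (\esum_(i in [set: I]) \esum_(n in [set: nat]) piece G i [set z | F n (i,
    z)]).
    apply: eq_esum => i _; rewrite -nneseries_esumT; last by move=> n; exact: piece_ge0.
    rewrite -piece_bigcup.
    - by congr (piece G i _); apply/seteqP; split=> z [n _ Fz]; exists n.
    - by move=> n; exact: measurable_section.
    - by move=> n m _ _ [z [Fn Fm]]; apply: tF => //; exists (i, z).
  by apply: exchange_esum => i n; exact: piece_ge0.
by apply: is_cvg_ereal_nneg_natsum => n _; exact: billiard_measure_ge0.
Qed.

HB.instance Definition _ G := isMeasure.Build _ (phase R I) R (billiard_measure G)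
  (billiard_measure0 G) (billiard_measure_ge0 G) (@billiard_measure_sigma_additive G).

End phase_measure.

(** * Invariance of the billiard measure *)

Section invariance.
Context {R : realType} {I : pointedType} (f : I -> nat).
Hypothesis f_inj : injective f.
Variable G : gas R I.
Hypotheses (HG : lorentz_gas G) (SA : standing_assumption G).
Hypothesis mT : measurable_fun setT (billiard_map G : phase R I -> phase R I).
Notation mu := (@lebesgue_measure R).
Notation T := (billiard_map G : phase R I -> phase R I).

Definition tangent_to_some (e : R * R) : set R :=
  [set p | exists i s, G i = Some s /\ tangent_lines s e p].

Lemma countable_tangent_to_some e : dot e e = 1 -> countable (tangent_to_some e).
Proof.
move=> e1.
have -> : tangent_to_some e = \bigcup_n
    (if index_of f n is Some i then if G i is Some s then tangent_lines s e else set0 else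
      set0).
  apply/seteqP; split=> p.
    by move=> [i [s [Gs tp]]]; exists (f i) => //; rewrite index_ofK// Gs.
  move=> [n _]; case: index_of => // i; case Gi : (G i) => [s|//] tp.
  by exists i, s.
apply: bigcup_countable; first exact: countableP.
move=> n _; case: index_of => [i|//]; case Gi : (G i) => [s|]; last exact: countable0.
apply: finite_set_countable; apply: finite_tangent_lines => //.
exact: gas_scatterer HG _ _ Gi.
Qed.

Variables (A : set (phase R I)) (mA : measurable A).
Variables (j : I) (S' : scatterer R).
Hypothesis GS' : G j = Some S'.
Let HS' : is_scatterer S' := gas_scatterer HG GS'.

Definition goes_to (i : I) : set (R * R) :=
  [set z | (T (i, z)).1 = j /\ A (T (i, z))].

Lemma measurable_goes_to i : measurable (goes_to i).
Proof.
have mj : measurable ([set x | x.1 = j] : set (phase R I)).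
  have := @measurable_fst _ _ (discrete I) (R * R)%type measurableT [set j] Logic.I.
  by rewrite setTI.
have mB : measurable (T @^-1` ([set x | x.1 = j] `&` A)).
  by rewrite -[_ @^-1` _]setTI; apply: mT => //; exact: measurableI.
exact: (measurable_section i mB).
Qed.

Definition lines_to (n : nat) (e : R * R) : set R :=
  if index_of f n is Some i then
    if G i is Some s then outgoing_lines s (goes_to i) e else set0 else set0.

(** The same flight seen from both ends: the offset is constant along it, and the outgoing velocity
    at the start is the incoming one at the end. *)
Lemma lines_toP n e p : dot e e = 1 -> lines_to n e p -> exists i s z y,
  [/\ f i = n, G i = Some s, collision G (i, z) (j, y) /\ A (j, y) &
   [/\ coordinates s z, coordinates S' y, 0 < sin z.2, velocity s z = e &
     cross e (position s z) = p /\ (cross e (position S' y) = p /\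
     reflect_along (tangent S' y.1) (velocity S' y) = e)]].
Proof.
move=> e1; rewrite /lines_to; case ki : index_of => [i|//]; case Gi : (G i) => [s|//].
move=> /(outgoing_linesP (gas_scatterer HG Gi) _ _ e1)[z [cz [Tj AT] sz vz pz]].
have ph : phase_space G (i, z) by exists s.
case E : (T (i, z)) Tj AT => [j0 y] /= jj0 Ay; subst j0.
have col := (billiard_mapP HG SA _ ph).1 E.
have [s1 [s2 [t [[/= Gs1 _] [/= Gs2 cy] _ /= py /= vy]]]] := col.
move: Gs1 Gs2; rewrite Gi GS' => -[?] [?]; subst s1 s2.
exists i, s, z, y; split.
- exact: index_of_inv ki.
- exact: Gi.
- exact: (conj col Ay).
- split; [exact: cz|exact: cy|exact: sz|exact: vz|split; first exact: pz].
  split.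
    rewrite py vz crossDr crossZr cross_same mulr0 addr0; exact: pz.
  rewrite vy reflect_alongK; [exact: vz|exact: tangent_unit].
Qed.

(** A flight may start transversally and end tangentially, or conversely, so the two sets of lines
    agree only after tangent lines are removed. *)
Lemma lines_to_incoming e : dot e e = 1 ->
  \bigcup_n (lines_to n e `\` tangent_to_some e) =
  incoming_lines S' [set z | A (j, z)] e `\` tangent_to_some e.
Proof.
move=> e1; apply/seteqP; split=> p.
  move=> [n _ [/(lines_toP e1)[i [s [z [y]]]] [fi Gi [col Ay]
    [cz cy sz vz [pz [py vy]]]] nt]].
  split=> //; exists y; split=> //.
  have : 0 <= sin y.2 := sin_coordinates_ge0 cy.
  rewrite le_eqVlt => /orP[/eqP/esym s0|//]; case: nt; exists j, S'; split=> //.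
  exists y.1; split=> //; first by case/coordinatesP : cy.
  rewrite crossC -vy cross_reflect_along opprK (cross_velocity HS') s0 oppr0.
  by [].
move=> [[y [cy Ay sy vy py]] nt].
(* The previous collision is found by letting the reversed particle fly from [y]. *)
have [x col] := collision_exists HG SA GS' (coordinates_reverse cy).
have := collision_rev HG col; rewrite /(reverse_phase (j, _)) /= reverseK.
case: (reverse_phase x) => i z {x col} col; have [s1 [s2 [t]]] := col.
move=> [[/= Gi cz] [/= Gs2 _] _ /= p2 /= v2].
move: Gs2; rewrite GS' => -[?]; subst s2.
have vz : velocity s1 z = e.
  by rewrite -vy v2 reflect_alongK//; exact: tangent_unit.
have pz : cross e (position s1 z) = p.
  by rewrite -py p2 vz crossDr crossZr cross_same mulr0 addr0.
have sz : 0 < sin z.2.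
  have : 0 <= sin z.2 := sin_coordinates_ge0 cz.
  rewrite le_eqVlt => /orP[/eqP/esym s0|//]; case: nt; exists i, s1; split=> //.
  exists z.1; split=> //; first by case/coordinatesP : cz.
  by rewrite crossC -vz (cross_velocity (gas_scatterer HG Gi)) s0 !oppr0.
have ph : phase_space G (i, z) by exists s1.
have Tz : T (i, z) = (j, y) by apply/(billiard_mapP HG SA _ ph).
exists (f i) => //; split=> //; rewrite /lines_to index_ofK// Gi.
apply/(outgoing_linesP (gas_scatterer HG Gi) _ _ e1).
by exists z; split=> //; rewrite /goes_to /= Tz.
Qed.

(** The line determines the point of arrival by [incoming_inj], and the reversed flight from there
    determines the scatterer of departure. *)
Lemma trivIset_lines_to e : dot e e = 1 ->
  trivIset setT (fun n => lines_to n e `\` tangent_to_some e).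
Proof.
move=> e1 n m _ _ [p [[Ln nt] [Lm _]]].
have sin_pos y : coordinates S' y -> cross e (position S' y) = p ->
    reflect_along (tangent S' y.1) (velocity S' y) = e -> 0 < sin y.2.
  move=> cy py vy; have : 0 <= sin y.2 := sin_coordinates_ge0 cy.
  rewrite le_eqVlt => /orP[/eqP/esym s0|//]; case: nt; exists j, S'; split=> //.
  exists y.1; split=> //; first by case/coordinatesP : cy.
  by rewrite crossC -vy cross_reflect_along opprK (cross_velocity HS') s0 oppr0.
have [i [s [z [y]]] [fi Gi [col Ay] [cz cy sz vz [pz [py vy]]]]] := lines_toP e1 Ln.
have [i' [s' [z' [y']]] [fi' Gi' [col' Ay'] [cz' cy' sz' vz' [pz' [py' vy']]]]] :=
  lines_toP e1 Lm.
have yy' : y = y'.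
  apply: (incoming_inj HS' cy cy' (sin_pos _ cy py vy) (sin_pos _ cy' py' vy') vy vy').
  by rewrite py py'.
subst y'.
have [ii' _] := collision_unique HG SA (collision_rev HG col) (collision_rev HG col').
by rewrite -fi -fi' ii'.
Qed.

Lemma measurable_lines_to n t : measurable (lines_to n (direction t)).
Proof.
rewrite /lines_to; case: index_of => [i|//]; case Gi : (G i) => [s|//].
have Hs := gas_scatterer HG Gi.
apply: (outgoing_lines_measure Hs _).1; apply: measurable_outgoing => //.
exact: measurable_goes_to.
Qed.

Local Open Scope ereal_scope.

Lemma measureD_countable (X N : set R) : measurable X -> countable N ->
  mu (X `\` N) = mu X.
Proof.
move=> mX cN; have mN := countable_measurable (@measurable_set1 R) cN.
have -> : mu X = mu (X `\` N) + mu (X `&` N) by exact: measureDI.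
suff -> : mu (X `&` N) = 0 by rewrite adde0.
apply/le_anti; rewrite measure_ge0 andbT -(countable_lebesgue_measure0 cN).
exact: measureIr.
Qed.

Lemma sum_lines_to t :
  \sum_(n <oo) mu (lines_to n (direction t)) =
  mu (incoming_lines S' [set z | A (j, z)] (direction t)).
Proof.
have e1 := direction_unit t; set e := direction t in e1 *.
have cN := countable_tangent_to_some e1.
have mN := countable_measurable (@measurable_set1 R) cN.
have mI := measurable_incoming_lines HS' t (measurable_section j mA).
rewrite -(measureD_countable mI cN) -lines_to_incoming//.
rewrite measure_semi_bigcup.
- by apply: eq_eseriesr => n _; apply/esym/measureD_countable => //;
  exact: measurable_lines_to.
- by move=> n; apply: measurableD => //; exact: measurable_lines_to.
- exact: trivIset_lines_to.
- by apply: bigcupT_measurable => n; apply: measurableD => //; exact: measurable_lines_to.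
Qed.

(** Invariance for the part of [A] on one scatterer: in each direction the arriving lines are sorted
    by their scatterer of departure, and the lengths are integrated over directions. *)
Lemma esum_goes_to :
  \esum_(i in [set: I]) piece G i (goes_to i) = piece G j [set z | A (j, z)].
Proof.
rewrite (esum_index f_inj); last by move=> i; exact: piece_ge0.
rewrite [RHS]/piece GS' (scatterer_measure_incoming HS'); last exact: measurable_section.
under eq_integral do rewrite -sum_lines_to.
have mL n : measurable_fun `[0%R, (pi *+ 2)%R[%classic (fun t => mu (lines_to n (direction
  t))).
  apply: measurable_funTS; rewrite /lines_to; case: index_of => [i|]; last first.
    by under eq_fun do rewrite measure0; exact: measurable_cst.
  case Gi : (G i) => [s|]; last by under eq_fun do rewrite measure0; exact: measurable_cst.
  by apply: measurable_mu_outgoing_lines;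
    [exact: gas_scatterer HG _ _ Gi|exact: measurable_goes_to].
rewrite integral_nneseries//.
apply: eq_eseriesr => n _; rewrite /lines_to; case: index_of => [i|] /=; last first.
  by under eq_integral do rewrite measure0; rewrite integral0.
rewrite /piece; case Gi : (G i) => [s|]; last first.
  by under eq_integral do rewrite measure0; rewrite integral0.
by apply: scatterer_measure_lines;
  [exact: gas_scatterer HG _ _ Gi|exact: measurable_goes_to].
Qed.

End invariance.

Section preservation.
Context {R : realType} {I : pointedType} (f : I -> nat).
Hypothesis f_inj : injective f.
Variable G : gas R I.
Hypotheses (HG : lorentz_gas G) (SA : standing_assumption G).
Hypothesis mT : measurable_fun setT (billiard_map G : phase R I -> phase R I).
Local Open Scope ereal_scope.

(** The preimage is split by departure and arrival index; exchanging the sums leaves one identity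
    for each arrival index. *)
Lemma billiard_map_preserves :
  measure_preserving (billiard_measure G : {measure set (phase R I) -> \bar R})
    (billiard_map G).
Proof.
move=> A mA; rewrite /= !billiard_measureE.
transitivity (\esum_(i in [set: I]) \esum_(j in [set: I]) piece G i (goes_to G A j i)).
  apply: eq_esum => i _.
  rewrite (esum_index f_inj); last by move=> j; exact: piece_ge0.
  pose F m := if index_of f m is Some j then goes_to G A j i else set0.
  have -> : [set z | (billiard_map G @^-1` A) (i, z)] = \bigcup_m F m.
    apply/seteqP; split=> z.
      move=> Az; exists (f (billiard_map G (i, z)).1) => //.
      by rewrite /F index_ofK.
    by move=> [m _]; rewrite /F; case: index_of => // j [].
  rewrite piece_bigcup.
  - apply: eq_eseriesr => m _; rewrite /F; case: index_of => //=.
    by rewrite /piece; case: (G i) => // s; exact: scatterer_measure0.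
  - by move=> m; rewrite /F; case: index_of => // j; exact: measurable_goes_to.
  - move=> m m' _ _ [z []]; rewrite /F; case k : index_of => [j|//];
    case k' : index_of => [j'|//].
    move=> [Tj _] [Tj' _].
    by rewrite -(index_of_inv k) -(index_of_inv k') -Tj -Tj'.
rewrite exchange_esum; last by move=> i j; exact: piece_ge0.
apply: eq_esum => j _; case Gj : (G j) => [S'|];
  first exact: (esum_goes_to f_inj HG SA mT mA Gj).
(* At an empty index nothing arrives, because the map keeps phase points in the phase space. *)
rewrite [RHS]/piece Gj esum1// => i _; rewrite /piece; case Gi : (G i) => [s|//].
rewrite /scatterer_measure (_ : _ `&` _ = set0) ?integral_set0//.
apply/seteqP; split=> // z [cz [Tj _]].
have : phase_space G (i, z) by exists s.
by move=> /(billiard_map_phase HG SA _).2[S']; rewrite Tj Gj.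
Qed.

End preservation.

(** * Slices and modified configurations *)

Section modified_gas.
Context {R : realType} {I : pointedType}.
Variables G G' : gas R I.
Hypotheses (HG : lorentz_gas G') (SA : standing_assumption G').
Implicit Types x y : phase R I.

Lemma hit_position (F : gas R I) (HF : lorentz_gas F) x y S S1 t : F x.1 = Some S ->
  F y.1 = Some S1 -> coordinates S1 y.2 ->
  position S1 y.2 = position S x.2 + t *: velocity S x.2 ->
  forall F' : gas R I, F' y.1 = F y.1 ->
  obstacles F' (position S x.2 + t *: velocity S x.2).
Proof.
move=> Fx Fy cy py F' F'y; exists y.1, S1; split; first by rewrite F'y.
rewrite -py; exact: (position_closure HF Fy cy).
Qed.

(** Each gas contains the scatterer hit in the other one, so neither first hit can precede the
    other. *)
Lemma collision_modified x y y' (HG0 : lorentz_gas G) :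
  G x.1 = G' x.1 -> G y.1 = G' y.1 -> G y'.1 = G' y'.1 ->
  collision G x y -> collision G' x y' -> y = y'.
Proof.
move=> Gx Gy Gy' [S [S1 [t [[GS cx] [GS1 cy] ft py vy]]]] col'.
apply: (collision_unique HG SA _ col').
have [S' [S1' [t' [[GS' cx'] [GS1' cy'] ft' py' vy']]]] := col'.
have ES : S' = S by move: GS'; rewrite -Gx GS => -[].
subst S'.
have O' := hit_position HG0 GS GS1 cy py (esym Gy).
have O := hit_position HG GS' GS1' cy' py' Gy'.
have [t0 _ free] := ft; have [t0' _ free'] := ft'.
have tt' : t = t'.
  case: (ltgtP t t') => // h; first by case: (free' t t0 h O').
  by case: (free t' t0' h O).
exists S, S1, t; split.
- exact: (conj GS' cx).
- by split; [rewrite -Gy; exact: GS1|exact: cy].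
- by rewrite tt'; exact: ft'.
- exact: py.
- exact: vy.
Qed.

End modified_gas.

Section site_slices.
Context {R : realType} {I : pointedType} (f : I -> nat).
Hypothesis f_inj : injective f.
Local Open Scope ereal_scope.
Implicit Types (G : gas R I) (A : set (phase R I)).

Definition slice (i : I) : set (phase R I) := [set x | x.1 = i].

Lemma measurable_slice i : measurable (slice i).
Proof.
have := @measurable_fst _ _ (discrete I) (R * R)%type measurableT [set i] Logic.I.
by rewrite setTI.
Qed.

Lemma billiard_measure_slice G i A : A `<=` slice i ->
  billiard_measure G A = piece G i [set z | A (i, z)].
Proof.
move=> Ai; rewrite billiard_measureE.
have <- := @esum_set1 R I i (fun k => piece G k [set z | A (k, z)]) (piece_ge0 _ _ _).
rewrite [RHS]esum_mkcond; apply: eq_esum => k _; case: ifPn => // /negP ki.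
rewrite /piece; case: (G k) => // s; rewrite (_ : [set z | _] = set0) ?scatterer_measure0//.
by apply/seteqP; split=> // z /Ai/= ?; apply: ki; exact/mem_set.
Qed.

Lemma billiard_measure_slice_fin G i : billiard_measure G (slice i) < +oo.
Proof.
rewrite (@billiard_measure_slice G i (slice i))// /piece; case: (G i) => [s|];
  last exact: ltry.
by apply: scatterer_measure_fin; exact: (measurable_section i (measurable_slice i)).
Qed.

Definition slice_seq (n : nat) : set (phase R I) :=
  if index_of f n is Some i then slice i else set0.

Lemma bigcup_slice_seq : \bigcup_n slice_seq n = setT.
Proof.
apply/seteqP; split=> // x _; exists (f x.1) => //.
by rewrite /slice_seq index_ofK.
Qed.

Lemma measurable_slice_seq n : measurable (slice_seq n).
Proof. by rewrite /slice_seq; case: index_of => // i; exact: measurable_slice. Qed.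

Lemma billiard_measure_slice_seq_fin G n : billiard_measure G (slice_seq n) < +oo.
Proof.
rewrite /slice_seq; case: index_of => [i|]; first exact: billiard_measure_slice_fin.
by rewrite measure0 ltry.
Qed.

Lemma billiard_measure_out G : billiard_measure G (~` phase_space G) = 0.
Proof.
rewrite billiard_measureE esum1// => i _; rewrite /piece; case Gi : (G i) => [s|//].
rewrite /scatterer_measure (_ : _ `&` _ = set0) ?integral_set0//.
by apply/seteqP; split=> // z [cz] /=; apply; exists s.
Qed.

(** Single sites have finite measure and cover the phase space, so they can serve as the cover in
    [conservative_cover]. The resulting condition is countable and involves no arbitrary set. *)
Lemma conservative_slices G (T := billiard_map G : phase R I -> phase R I) :
  measurable_fun setT T ->
  measure_preserving (billiard_measure G : {measure set (phase R I) -> \bar R}) T ->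
  conservative (billiard_measure G : {measure set (phase R I) -> \bar R}) T <->
  forall i, piece G i [set z | no_return T (slice i) (i, z)] = 0.
Proof.
move=> mT pT; have sub i : no_return T (slice i) `<=` slice i by move=> x [].
split=> [cT i|h].
  by rewrite -(billiard_measure_slice G (sub i)); exact: cT (measurable_slice i).
apply: (@conservative_cover _ _ _ _ _ slice_seq) => //.
- exact: measurable_slice_seq.
- by move=> k; exact: billiard_measure_slice_seq_fin.
- by rewrite bigcup_slice_seq setCT measure0.
- move=> k; have m0 : billiard_measure G (no_return T (slice_seq k)) = 0.
    rewrite /slice_seq; case: index_of => [i|].
      by rewrite (billiard_measure_slice G (sub i)).
    by rewrite (_ : no_return T set0 = set0) ?measure0//; apply/seteqP; split=> // x [].
  exists (no_return T (slice_seq k)); split=> //.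
  by apply: measurable_no_return => //; exact: measurable_slice_seq.
Qed.

(** [recurrent] tests only subsets of the phase space, but the complement has measure 0. *)
Lemma recurrent_conservative G (T := billiard_map G : phase R I -> phase R I) :
  measurable_fun setT T -> measurable (phase_space G) ->
  recurrent G <-> conservative (billiard_measure G : {measure set (phase R I) -> \bar R}) T.
Proof.
move=> mT mP; split=> [rG A mA|cT A mA AP].
  have mN := measurable_no_return mT mA.
  have mnP := measurableC mP.
  suff : (billiard_measure G).-negligible (no_return T A).
    by move=> [N [mN' N0 sub]]; apply/le_anti;
      rewrite measure_ge0 andbT -N0 le_measure ?inE.
  apply: (@negligibleS _ _ _ _ ((~` [set x | (A `&` phase_space G) x ->
      exists2 n, (1 <= n)%N & (A `&` phase_space G) (iter n T x)]) `|` ~` phase_space G)).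
    move=> x [Ax nr]; have [Px|nPx] := pselect (phase_space G x); last by right.
    by left => /(_ (conj Ax Px))[n n1 [An _]]; exact: nr An.
  apply: negligibleU; first by apply: rG; [exact: measurableI|exact: subIsetr].
  by exists (~` phase_space G); split=> //; exact: billiard_measure_out.
exists (no_return T A); split; [exact: measurable_no_return|exact: cT|].
move=> x nx; split; first by apply: contrapT => nAx; apply: nx => /nAx.
by move=> n n0 An; apply: nx => _; exists n.
Qed.

End site_slices.

(** * Random Lorentz gases *)

Section random_lorentz_gas.
Context {R : realType} {d : measure_display} {Omega : measurableType d}.
Variables (e1 e2 : R * R) (fixed : nat -> option (scatterer R)).
Variable config : Omega -> seq (scatterer R).
Hypothesis mconfig : measurable_config e1 e2 fixed config.
Hypothesis all_lorentz : forall l : gas_space Omega,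
  lorentz_gas (random_gas e1 e2 fixed config l) /\
  standing_assumption (random_gas e1 e2 fixed config l).
Notation rgas l := (random_gas e1 e2 fixed config l).
Notation mu := (@lebesgue_measure R).
Implicit Types (l : gas_space Omega) (a : site).

Definition site_index (a : site) : nat := pickle (a : (int * int) * (nat + nat)).

Lemma site_index_inj : injective site_index.
Proof. exact: pcan_inj pickleK. Qed.

(* [0] at the empty sites. *)
Definition perimeter_at l a : R := oapp (@perim R) 0 (rgas l a).

Lemma measurable_perimeter_at a : measurable_fun setT (fun l => perimeter_at l a).
Proof.
case: a => g [i|j].
  have -> : (fun l => perimeter_at l (g, inl i)) =
      (fun w => oapp (@perim R) 0 (onth (config w) i)) \o (fun l : gas_space Omega => l g).
    by apply/funext => l; rewrite /perimeter_at /random_gas /=; case: onth.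
  apply: measurableT_comp; first exact: measurable_perim mconfig i.
  exact: measurable_coordinate.
rewrite (_ : (fun l => _) = cst (oapp (@perim R) 0 (fixed j))); first exact: measurable_cst.
by apply/funext => l; rewrite /perimeter_at /random_gas /=; case: fixed.
Qed.

(** At an empty site the perimeter is 0 and the chart is empty, so the phase space is described by
    inequalities that are uniform in [l]. *)
Definition chart l a : set (R * R) :=
  [set z | [/\ 0 <= z.1, z.1 < perimeter_at l a & 0 <= z.2 <= pi]].

Lemma phase_spaceE l a z : phase_space (rgas l) (a, z) <-> chart l a z.
Proof.
rewrite /phase_space /chart /perimeter_at /=; case: (rgas l a) => [s|] /=.
  split=> [[_ [<-] /coordinatesP[+ c]]|[z0 zp c]].
    by rewrite in_itv/= => /andP[].
  by exists s => //; apply/coordinatesP; rewrite in_itv/= z0.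
split=> [[s]//|[z0 /(le_lt_trans z0)]]; by rewrite ltxx.
Qed.

Lemma measurable_charts a :
  measurable [set p : gas_space Omega * (R * R) | chart p.1 a p.2].
Proof.
pose pr (p : gas_space Omega * (R * R)) := p.2.1.
pose pphi (p : gas_space Omega * (R * R)) := p.2.2.
pose pper (p : gas_space Omega * (R * R)) := perimeter_at p.1 a - p.2.1.
have mr : measurable_fun setT pr.
  by apply: (@measurableT_comp _ _ _ _ _ _ fst) => //; exact: measurable_snd.
have mphi : measurable_fun setT pphi.
  by apply: (@measurableT_comp _ _ _ _ _ _ snd) => //; exact: measurable_snd.
have mper : measurable_fun setT pper.
  apply: measurable_funB => //.
  by apply: (@measurableT_comp _ _ _ _ _ _ (fun l => perimeter_at l a));
    [exact: measurable_perimeter_at|exact: measurable_fst].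
have -> : [set p : gas_space Omega * (R * R) | chart p.1 a p.2] =
    (pr @^-1` `[0, +oo[%classic) `&` (pper @^-1` `]0, +oo[%classic) `&`
    (pphi @^-1` `[0, pi]%classic).
  apply/seteqP; split=> p /=; rewrite !in_itv/= !andbT /pper subr_gt0.
    by move=> [].
  by move=> [[]].
apply: measurableI; first apply: measurableI.
- by rewrite -[_ @^-1` _]setTI; exact: mr.
- by rewrite -[_ @^-1` _]setTI; exact: mper.
- by rewrite -[_ @^-1` _]setTI; exact: mphi.
Qed.

Lemma bigcup_site_measurable d' (X : measurableType d') (F : site -> set X) :
  (forall a, measurable (F a)) -> measurable (\bigcup_a F a).
Proof.
move=> mF; have -> : \bigcup_a F a =
    \bigcup_n (if index_of site_index n is Some a then F a else set0).
  apply/seteqP; split=> x.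
    by move=> [a _ Fa]; exists (site_index a) => //; rewrite (index_ofK site_index_inj).
  by move=> [n _]; case: index_of => // a Fa; exists a.
by apply: bigcupT_measurable => n; case: index_of.
Qed.

Lemma measurable_phase_spaces :
  measurable [set p : gas_space Omega * phase R site | phase_space (rgas p.1) p.2].
Proof.
have -> : [set p : gas_space Omega * phase R site | phase_space (rgas p.1) p.2] =
    \bigcup_a ((fun p : gas_space Omega * phase R site => (p.2.1 : discrete site)) @^-1`
      [set a] `&`
     (fun p : gas_space Omega * phase R site => (p.1, p.2.2)) @^-1` [set p | chart p.1 a
       p.2]).
  apply/seteqP; split=> [[l [a z]] /= /phase_spaceE h|[l [a z]] [b _ [/= -> h]]].
    by exists a.
  exact/phase_spaceE.
apply: bigcup_site_measurable => a; apply: measurableI.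
  have m2 : measurable_fun setT (fun p : gas_space Omega * phase R site => (p.2.1 :
    discrete site)).
    by apply: (@measurableT_comp _ _ _ _ _ _ (fst : phase R site -> discrete site)) => //;
      exact: measurable_snd.
  by rewrite -[_ @^-1` _]setTI; exact: m2.
have m12 : measurable_fun setT (fun p : gas_space Omega * phase R site => (p.1, p.2.2)).
  apply: measurable_fun_pair; first exact: measurable_fst.
  by apply: (@measurableT_comp _ _ _ _ _ _ (snd : phase R site -> R * R)) => //;
    exact: measurable_snd.
by rewrite -[_ @^-1` _]setTI; apply: m12 => //; exact: measurable_charts.
Qed.

Lemma measurable_billiard_maps :
  measurable_fun setT (fun p : gas_space Omega * phase R site => billiard_map (rgas p.1)
    p.2).
Proof.
have mD := measurable_phase_spaces; set D := [set p | _] in mD.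
rewrite -(setvU D); apply/measurable_funU => //; first exact: measurableC.
split; last exact: measurable_dynamics mconfig.
(* Off the phase space the map takes its dummy value, the point itself. *)
apply: (eq_measurable_fun snd); last exact: measurable_funTS measurable_snd.
by move=> p /set_mem nD; rewrite billiard_map_out.
Qed.

Lemma measurable_billiard_map l :
  measurable_fun setT (billiard_map (rgas l) : phase R site -> phase R site).
Proof. have := measurable_billiard_maps; exact: measurable_fun_pair2. Qed.

Lemma measurable_phase_space l : measurable (phase_space (rgas l) : set (phase R site)).
Proof.
have := @measurable_xsection _ _ (gas_space Omega) (phase R site) _ l
  measurable_phase_spaces.
by rewrite xsectionE.
Qed.

Lemma rgas_preserves l : measure_preserving
  (billiard_measure (rgas l) : {measure set (phase R site) -> \bar R}) (billiard_map (rgas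
    l)).
Proof.
have [HG SA] := all_lorentz l.
by apply: (billiard_map_preserves site_index_inj) => //; exact: measurable_billiard_map.
Qed.

Lemma recurrentP l : recurrent (rgas l) <->
  conservative (billiard_measure (rgas l) : {measure set (phase R site) -> \bar R})
    (billiard_map (rgas l)).
Proof.
by apply: recurrent_conservative;
  [exact: measurable_billiard_map|exact: measurable_phase_space].
Qed.

(** All billiard maps together form one measurable map [Phi] that leaves the configuration fixed,
    and the set is a preimage of a no-return set of [Phi]. *)
Lemma measurable_no_return_sites a : measurable
  [set p : gas_space Omega * (R * R) | no_return (billiard_map (rgas p.1)) (slice a) (a,
    p.2)].
Proof.
pose Phi (p : gas_space Omega * phase R site) := (p.1, billiard_map (rgas p.1) p.2 : phase
  R site).
have mPhi : measurable_fun setT Phi.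
  by apply: measurable_fun_pair; [exact: measurable_fst|exact: measurable_billiard_maps].
have PhiE n l x : iter n Phi (l, x) = (l, iter n (billiard_map (rgas l)) x).
  elim: n => [|n IH]; first reflexivity.
  rewrite !iterS IH; reflexivity.
pose slices : set (gas_space Omega * phase R site) := snd @^-1` slice a.
have ms : measurable slices.
  by rewrite -[slices]setTI; apply: measurable_snd => //; exact: measurable_slice.
pose emb (p : gas_space Omega * (R * R)) : gas_space Omega * phase R site := (p.1, (a :
  discrete site, p.2)).
have memb : measurable_fun setT emb.
  apply: measurable_fun_pair; first exact: measurable_fst.
  by apply: measurable_fun_pair; [exact: measurable_cst|exact: measurable_snd].
have -> : [set p : gas_space Omega * (R * R) | no_return (billiard_map (rgas p.1)) (slice
  a) (a, p.2)] =
    emb @^-1` (no_return Phi slices).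
  apply/seteqP; split=> -[l z] [_ nr]; split.
  - reflexivity.
  - by move=> n n0; rewrite /slices /emb /= PhiE; exact: nr n n0.
  - reflexivity.
  - by move=> n n0; have := nr n n0; rewrite /slices /emb /= PhiE.
rewrite -[_ @^-1` _]setTI; apply: memb => //.
exact: measurable_no_return mPhi ms.
Qed.

(** The density does not depend on the scatterer, so [l] enters only through the domain of
    integration. *)
Lemma pieceE l a B : piece (rgas l) a B =
  (\int[mu \x mu]_(z in chart l a `&` B) (sin z.2)%:E)%E.
Proof.
rewrite /piece; case E : (rgas l a) => [s|].
  rewrite /scatterer_measure; congr (integral _ _ _); congr (_ `&` _).
  apply/seteqP; split=> z; rewrite -phase_spaceE.
    by move=> c; exists s.
  by move=> [s']; rewrite /= E => -[<-].
rewrite (_ : _ `&` _ = set0) ?integral_set0//; apply/seteqP; split=> // z [].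
by rewrite -phase_spaceE => -[s']; rewrite /= E.
Qed.

Lemma measurable_piece a (B : set (gas_space Omega * (R * R))) : measurable B ->
  measurable_fun setT (fun l => piece (rgas l) a [set z | B (l, z)]).
Proof.
move=> mB.
pose D := [set p : gas_space Omega * (R * R) | chart p.1 a p.2] `&` B.
have mD : measurable D by apply: measurableI => //; exact: measurable_charts.
pose h : gas_space Omega * (R * R) -> \bar R := (fun p => (sin p.2.2)%:E) \_ D.
have mh : measurable_fun setT h.
  apply/(measurable_restrictT _ _).1 => //; apply/measurable_EFinP; apply: measurable_funTS.
  apply: measurableT_comp; first exact: continuous_measurable_fun (@continuous_sin R).
  by apply: (@measurableT_comp _ _ _ _ _ _ snd) => //; exact: measurable_snd.
have h0 p : (0 <= h p)%E.
  by apply: erestrict_ge0 => {}p [[_ _ c] _]; rewrite lee_fin; exact: sin_ge0_pi.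
(* Regrouped so that the angle, and then the arc length, can be integrated out with [l] as a
   parameter. *)
pose assoc (p : gas_space Omega * R * R) := (p.1.1, (p.1.2, p.2)).
have massoc : measurable_fun setT assoc.
  have m1 : measurable_fun setT (fun p : gas_space Omega * R * R => p.1) by exact:
    measurable_fst.
  apply: measurable_fun_pair; first exact: measurableT_comp measurable_fst m1.
  by apply: measurable_fun_pair;
    [exact: measurableT_comp measurable_snd m1|exact: measurable_snd].
pose F1 := fubini_F mu (h \o assoc).
have mF1 : measurable_fun setT F1.
  by apply: measurable_fun_fubini_tonelli_F; [exact: measurableT_comp|move=> p /=;
    exact: h0].
have F10 p : (0 <= F1 p)%E by apply: integral_ge0 => t _; exact: h0.
have := @measurable_fun_fubini_tonelli_F _ _ _ _ _ mu F1 mF1 F10.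
congr (measurable_fun _ _); apply/funext => l.
rewrite pieceE integral_mkcond fubini_tonelli1.
- apply: eq_integral => r _; apply: eq_integral => t _ /=.
  rewrite /h !patchE; congr (if _ then _ else _).

- exact: (measurable_fun_pair2 l mh).
- by move=> z; apply: erestrict_ge0 => {}z [[_ _ c] _]; rewrite lee_fin; exact: sin_ge0_pi.
Qed.

Lemma measurable_recurrent : measurable [set l : gas_space Omega | recurrent (rgas l)].
Proof.
pose B a := [set p : gas_space Omega * (R * R) |
  no_return (billiard_map (rgas p.1)) (slice a) (a, p.2)].
have -> : [set l | recurrent (rgas l)] = ~` (\bigcup_a
    ((fun l => piece (rgas l) a [set z | B a (l, z)]) @^-1` (~` [set 0%E]))).
  apply/seteqP; split=> l /=.
    move=> /recurrentP/(conservative_slices site_index_inj (@measurable_billiard_map l)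
      (@rgas_preserves l)) h.
    by move=> [a _]; apply; exact: h.
  move=> h; apply/recurrentP/(conservative_slices site_index_inj (@measurable_billiard_map
    l) (@rgas_preserves l)).
  by move=> a; apply: contrapT => ha; apply: h; exists a.
apply: measurableC; apply: bigcup_site_measurable => a.
rewrite -[_ @^-1` _]setTI; apply: measurable_piece => //.
  exact: measurable_no_return_sites.
by apply: measurableC; exact: emeasurable_set1.
Qed.

(** * Changing the configuration of one cell *)

Section one_cell.
Variables (g : int * int) (l l' : gas_space Omega).
Hypothesis agree : forall h, h <> g -> l h = l' h.

(** Only the random sites of the cell [g] are excluded; its fixed scatterers are common to both
    gases. *)
Definition unchanged : set (phase R site) :=
  [set x | ~ exists i, x.1 = (g, inl i)].

Lemma rgas_unchanged x : unchanged x -> rgas l x.1 = rgas l' x.1.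
Proof.
case: x => -[h [i|j]] z ux //; rewrite /random_gas /= agree// => hg.
by apply: ux; exists i; rewrite /= hg.
Qed.

Lemma measurable_unchanged : measurable unchanged.
Proof.
have := @measurable_fst _ _ (discrete site) (R * R)%type measurableT [set a | ~ exists i, a
  = (g, inl i)] Logic.I.
by rewrite setTI.
Qed.

(** The random sites of [g] beyond the length of the finite sequence [config (m g)] are empty and
    carry no measure; the others are finitely many, each of finite measure. *)
Lemma billiard_measure_changed_fin (m : gas_space Omega) :
  (billiard_measure (rgas m) (~` unchanged) < +oo)%E.
Proof.
have mP := measurable_phase_space m; have mu := measurable_unchanged.
pose n := size (config (m g)); pose F i : set (phase R site) := slice ((g, inl i) : site).
have mF i : measurable (F i) by exact: measurable_slice.
have mU : measurable (\big[setU/set0]_(i < n) F i) by apply: bigsetU_measurable.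
have sub : ~` unchanged `<=` \big[setU/set0]_(i < n) F i `|` ~` phase_space (rgas m).
  move=> [a z] /contrapT[i /= ai]; have [lt_in|ge_ni] := ltnP i n.
    by left; rewrite -bigcup_mkord; exists i.
  right => -[s]; rewrite /= ai /random_gas /= onth_default//.
apply: (@le_lt_trans _ _ (billiard_measure (rgas m) (\big[setU/set0]_(i < n) F i `|` ~`
  phase_space (rgas m)))).
  by apply: le_measure; rewrite ?inE//; [exact: measurableC|apply: measurableU => //;
    exact: measurableC].
apply: (@le_lt_trans _ _ (billiard_measure (rgas m) (\big[setU/set0]_(i < n) F i) +
   billiard_measure (rgas m) (~` phase_space (rgas m)))%E).
  by apply: measureU2 => //; exact: measurableC.
rewrite billiard_measure_out adde0.
apply: (@le_lt_trans _ _ (\sum_(i < n) billiard_measure (rgas m) (F i))%E).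
  exact: (@Boole_inequality _ _ _ (billiard_measure (rgas m)) F n).
by apply: lte_sum_pinfty => i _; exact: billiard_measure_slice_fin.
Qed.

Lemma billiard_map_unchanged x : unchanged x ->
  unchanged (billiard_map (rgas l) x) -> unchanged (billiard_map (rgas l') x) ->
  billiard_map (rgas l) x = billiard_map (rgas l') x.
Proof.
move=> ux uy uy'; have Ex := rgas_unchanged ux.
have [HG SA] := all_lorentz l; have [HG' SA'] := all_lorentz l'.
have [px|npx] := pselect (phase_space (rgas l) x); last first.
  rewrite !billiard_map_out// => -[s Gs cs]; apply: npx; exists s => //.
  by rewrite Ex.
have px' : phase_space (rgas l') x.
  by case: px => s Gs cs; exists s => //; rewrite -Ex.
apply: (collision_modified HG' SA' HG Ex (rgas_unchanged uy) (rgas_unchanged uy')).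
  exact/(billiard_mapP HG SA _ px).
exact/(billiard_mapP HG' SA' _ px').
Qed.

Lemma recurrent_one_cell : recurrent (rgas l) -> recurrent (rgas l').
Proof.
move=> /recurrentP cT; apply/recurrentP.
apply: (@conservative_modification _ _ _ _ _ _ _ unchanged (slice_seq site_index)
  (@measurable_billiard_map l) (@measurable_billiard_map l')
  (@rgas_preserves l) (@rgas_preserves l') _ _ _ _ _ _ _ _ cT).
- exact: measurable_unchanged.
- move=> A mA Au; rewrite /= !billiard_measureE; apply: eq_esum => a _.
  have [ua|ua] := pselect (exists i, a = (g, inl i)).
    rewrite (_ : [set z | A (a, z)] = set0) ?/piece; last first.
      by apply/seteqP; split=> // z /Au; apply.
    by case: (rgas l a) => [?|]; case: (rgas l' a) => [?|]; rewrite ?scatterer_measure0.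
  by rewrite /piece (@rgas_unchanged (a, (0, 0))).
- exact: billiard_measure_changed_fin.
- exact: billiard_measure_changed_fin.
- exact: billiard_map_unchanged.
- by move=> k; exact: measurable_slice_seq.
- by move=> k; exact: billiard_measure_slice_seq_fin.
- exact: (bigcup_slice_seq site_index_inj).
Qed.

End one_cell.

End random_lorentz_gas.

Theorem theorem4p2 (R : realType)
    (e1 e2 : R * R) (basis_e : cross e1 e2 != 0)
    (C0 : set (R * R)) (cell_C0 : is_cell e1 e2 C0)
    (d : measure_display) (Omega : measurableType d)
    (P : probability Omega R)
    (Q : probability (gas_space Omega) R) (product_Q : is_product_law P Q)
    (fixed : nat -> option (scatterer R))
    (config : Omega -> seq (scatterer R))
    (config_in_cell : forall w i S, onth (config w) i = Some S ->
       body S `<=` C0)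
    (config_measurable : measurable_config e1 e2 fixed config)
    (all_lorentz : forall l : gas_space Omega,
       lorentz_gas (random_gas e1 e2 fixed config l) /\
       standing_assumption (random_gas e1 e2 fixed config l)) :
  let Rec := [set l : gas_space Omega |
                recurrent (random_gas e1 e2 fixed config l)] in
  completed_algebra_gen Q Rec /\
  (@completed_measure_extension _ _ _ Q Rec = 0%E \/
   @completed_measure_extension _ _ _ Q Rec = 1%E).
Proof.
move=> Rec.
have mRec : measurable Rec by exact: measurable_recurrent.
have [cRec ->] := measurable_completed Q mRec; split=> //.
apply: (kolmogorov_zero_one product_Q mRec) => g w l.
have agree h : h <> g -> update [:: g] w l h = l h.
  by rewrite /update inE => /eqP/negbTE ->.
(* The two configurations play symmetric roles, so the one-sided transfer gives both
   implications. *)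
split; apply: (@recurrent_one_cell _ _ _ _ _ _ _ config_measurable all_lorentz g) => // h
  /agree.
by move=> ->.
Qed.
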